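(* Let $X \subset \mathbb{R}^n$ be a rectangular set and let $f: X \to \mathbb{R}^n$ be differentiable, with Jacobian $Df(x)$ at $x \in X$. For $x\in X$ let $\mathcal{G}_{f(x)}$ be the set of all DSR graphs $G_{A, B^T}$, where $A$ is a real $n \times m$ matrix and $B$ a real $m \times n$ matrix ($m \in \mathbb{N}$ arbitrary) with $AB = -Df(x)$. 1. If, at each $x \in X$, there exists a nondegenerate DSR graph $G \in \mathcal{G}_{f(x)}$ containing no e-cycles, then $f$ is injective on $X$ and, for every $q \in \mathcal{D}_d^{+}(X)$, $f - q$ is injective on $X$. 2. If $X$ is open and, at each $x \in X$, there exists a weakly nondegenerate DSR graph $G \in \mathcal{G}_{f(x)}$ containing no e-cycles, then $f$ is injective on $X$ and, for every $q \in \mathcal{D}_d^{+}(X)$, $f - q$ is injective on $X$.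
   Context: A rectangular subset of $\mathbb{R}^n$ is a product of $n$ intervals, each of which may be closed or nonclosed, bounded or unbounded. $\mathcal{D}_d^{+}(X)$ is the set of all differentiable functions $q: X \to \mathbb{R}^n$ of the form $q(x) = [q_1(x_1), \ldots, q_n(x_n)]^T$ with $\frac{\partial q_i}{\partial x_i} > 0$ everywhere on $X$ for each $i$. DSR graphs. Given an ordered pair $(A,B)$ of real $n \times m$ matrices, the DSR graph $G_{A,B}$ is a bipartite signed multigraph with $n$ S-vertices (S-vertex $i$ corresponds to row $i$) and $m$ R-vertices (R-vertex $j$ corresponds to column $j$). Each edge joins an S-vertex and an R-vertex, has a sign, and has S-to-R direction, R-to-S direction, or both (in which case it is called undirected). The edges between S-vertex $i$ and R-vertex $j$ are as follows. If $A_{ij}=B_{ij}=0$ there is none. If $A_{ij} \neq 0$, $B_{ij} = 0$: a single edge with R-to-S direction and the sign of $A_{ij}$. If $A_{ij}=0$, $B_{ij} \neq 0$: a single edge with S-to-R direction and the sign of $B_{ij}$. If $A_{ij}B_{ij} > 0$: a single undirected edge with the sign of $A_{ij}$. If $A_{ij}B_{ij} < 0$: two distinct edges, one with R-to-S direction and the sign of $A_{ij}$, one with S-to-R direction and the sign of $B_{ij}$. Cycles. A cycle in a DSR graph is a closed path of distinct edges, not repeating vertices, which can be traversed consistently with the directions of its edges (undirected edges may be traversed in either direction). In particular two distinct edges between the same pair of vertices, one traversed S-to-R and the other R-to-S, form a cycle of length 2. The sign of a cycle $C$ is the product of the signs of its edges, and its parity is $P(C) = (-1)^{|C|/2}\,\mathrm{sign}(C)$,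 where $|C|$ is its (even) length. $C$ is an e-cycle if $P(C)=1$. Nondegeneracy. For nonempty $\gamma \subset \{1,\ldots,n\}$ and $\delta \subset \{1,\ldots,m\}$, let $G(\gamma|\delta) = G_{A(\gamma|\delta), B(\gamma|\delta)}$, where $M(\gamma|\delta)$ is the submatrix of $M$ with rows indexed by $\gamma$ and columns indexed by $\delta$; $G(\gamma|\delta)$ is regarded as a subgraph of $G=G_{A,B}$. When $|\gamma|=|\delta|$, a term subgraph of $G(\gamma|\delta)$ is a subgraph on all of its vertices in which each vertex has exactly one edge incident on it (a perfect matching). It has S-to-R (resp. R-to-S) direction if all of its edges have S-to-R (resp. R-to-S) direction; undirected edges have both. An $n \times m$ DSR graph $G$ is weakly nondegenerate if there is $\delta \subset \{1,\ldots,m\}$ with $|\delta|=n$ such that $G(\{1,\ldots,n\}|\delta)$ contains both a term subgraph with S-to-R direction and a term subgraph with R-to-S direction. $G$ is nondegenerate if for every nonempty $\gamma \subset \{1,\ldots,n\}$ there is $\delta \subset \{1,\ldots,m\}$ with $|\delta|=|\gamma|$ such that $G(\gamma|\delta)$ is weakly nondegenerate. *)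

(* Defs.v *)
From HB Require Import structures.
From mathcomp Require Import all_boot all_order all_algebra.
Set Implicit Arguments.
Unset Strict Implicit.
Unset Printing Implicit Defensive.
Import Order.TTheory GRing.Theory Num.Theory.
Local Open Scope ring_scope.

Variant direction := StoR | RtoS | Undirected.

Definition direction_code (d : direction) : option bool :=
  match d with
  | StoR => Some true
  | RtoS => Some false
  | Undirected => None
  end.

Definition direction_decode (o : option bool) : direction :=
  match o with
  | Some true => StoR
  | Some false => RtoS
  | None => Undirected
  end.

Fact direction_codeK : cancel direction_code direction_decode.
Proof. by case. Qed.

HB.instance Definition _ := Finite.copy direction (can_type direction_codeK).

Definition has_StoR (d : direction) : bool := d != RtoS.
Definition has_RtoS (d : direction) : bool := d != StoR.

(* [negative e] tells that the sign of [e] is -1. *)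
Record edge (n m : nat) := Edge {
  svertex : 'I_n;
  rvertex : 'I_m;
  negative : bool;
  dir : direction }.

Definition edge_code (n m : nat) (e : edge n m) :=
  (svertex e, rvertex e, negative e, dir e).

Definition edge_decode (n m : nat) (t : 'I_n * 'I_m * bool * direction) :=
  Edge t.1.1.1 t.1.1.2 t.1.2 t.2.

Fact edge_codeK (n m : nat) : cancel (@edge_code n m) (@edge_decode n m).
Proof. by case. Qed.

HB.instance Definition _ (n m : nat) :=
  Finite.copy (edge n m) (can_type (@edge_codeK n m)).

Definition edge_sign (n m : nat) (e : edge n m) : int := (-1) ^+ negative e.

(* A bipartite signed multigraph on fixed vertices is given by its set of
   edges. Parallel edges of a DSR graph always differ by their directions, so
   that no multiplicities are needed. *)
Definition dsr (n m : nat) := {set edge n m}.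

(* The (sign, direction) labels of the edges between S-vertex i and R-vertex j
   of G_{A,B}, for a = A i j and b = B i j. *)
Definition dsr_labels (R : realDomainType) (a b : R) : seq (bool * direction) :=
  if a == 0 then
    if b == 0 then [::] else [:: (b < 0, StoR)]
  else if b == 0 then [:: (a < 0, RtoS)]
  else if 0 < a * b then [:: (a < 0, Undirected)]
  else [:: (a < 0, RtoS); (b < 0, StoR)].

Definition dsr_graph (R : realDomainType) (n m : nat) (A B : 'M[R]_(n, m)) :
    dsr n m :=
  [set e | (negative e, dir e) \in
             dsr_labels (A (svertex e) (rvertex e)) (B (svertex e) (rvertex e))].

(* An edge together with the way it is traversed: S-to-R when the boolean is
   [true], R-to-S otherwise. *)
Definition step (n m : nat) := (edge n m * bool)%type.

Definition step_allowed (n m : nat) (p : step n m) : bool :=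
  if p.2 then has_StoR (dir p.1) else has_RtoS (dir p.1).

Definition step_source (n m : nat) (p : step n m) : 'I_n + 'I_m :=
  if p.2 then inl (svertex p.1) else inr (rvertex p.1).

Definition step_target (n m : nat) (p : step n m) : 'I_n + 'I_m :=
  if p.2 then inr (rvertex p.1) else inl (svertex p.1).

Definition dsr_cycle (n m : nat) (G : dsr n m) (c : seq (step n m)) : bool :=
  [&& c != [::],
      all (fun p => (p.1 \in G) && step_allowed p) c,
      path.cycle (fun p q => step_target p == step_source q) c,
      uniq [seq step_source p | p <- c]
    & uniq [seq p.1 | p <- c]].

Definition cycle_sign (n m : nat) (c : seq (step n m)) : int :=
  \prod_(p <- c) edge_sign p.1.

Definition cycle_parity (n m : nat) (c : seq (step n m)) : int :=
  (-1) ^+ (size c)./2 * cycle_sign c.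

Definition e_cycle (n m : nat) (G : dsr n m) (c : seq (step n m)) : bool :=
  dsr_cycle G c && (cycle_parity c == 1).

Definition has_e_cycle (n m : nat) (G : dsr n m) : Prop :=
  exists c : seq (step n m), e_cycle G c.

(* G(gamma|delta) as a subgraph of G: since the edges of G_{A,B} are determined
   entrywise, passing to the submatrices keeps exactly the edges between gamma
   and delta. *)
Definition dsr_sub (n m : nat) (G : dsr n m) (gamma : {set 'I_n})
    (delta : {set 'I_m}) : dsr n m :=
  [set e in G | (svertex e \in gamma) && (rvertex e \in delta)].

Definition term_subgraph (n m : nat) (G : dsr n m) (gamma : {set 'I_n})
    (delta : {set 'I_m}) (T : dsr n m) : bool :=
  [&& T \subset dsr_sub G gamma delta,
      [forall i in gamma, #|[set e in T | svertex e == i]| == 1%N]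
    & [forall j in delta, #|[set e in T | rvertex e == j]| == 1%N]].

(* Weak nondegeneracy of G(gamma|delta), as a #|gamma| x #|delta| DSR graph. *)
Definition dsr_weakly_nondegenerate_sub (n m : nat) (G : dsr n m)
    (gamma : {set 'I_n}) (delta : {set 'I_m}) : Prop :=
  exists delta' : {set 'I_m},
    [/\ delta' \subset delta,
        #|delta'| = #|gamma|,
        exists T : dsr n m,
          term_subgraph G gamma delta' T /\ {in T, forall e, has_StoR (dir e)}
      & exists T : dsr n m,
          term_subgraph G gamma delta' T /\ {in T, forall e, has_RtoS (dir e)}].

Definition dsr_weakly_nondegenerate (n m : nat) (G : dsr n m) : Prop :=
  dsr_weakly_nondegenerate_sub G [set: 'I_n] [set: 'I_m].

Definition dsr_nondegenerate (n m : nat) (G : dsr n m) : Prop :=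
  forall gamma : {set 'I_n}, gamma != set0 ->
  exists delta : {set 'I_m},
    #|delta| = #|gamma| /\ dsr_weakly_nondegenerate_sub G gamma delta.

(* [dsr_factor J G]: G = G_{A, B^T} for some factorisation A B = - J. *)
Definition dsr_factor (R : realDomainType) (n m : nat) (J : 'M[R]_n)
    (G : dsr n m) : Prop :=
  exists (A : 'M[R]_(n, m)) (B : 'M[R]_(m, n)),
    A *m B = - J /\ G = dsr_graph A B^T.

From mathcomp Require Import all_classical all_reals all_analysis.
Import numFieldNormedType.Exports.
Local Open Scope classical_set_scope.

Definition rectangular (R : realType) (n : nat) (X : set 'cV[R]_n) : Prop :=
  exists I : 'I_n -> interval R, X = [set x : 'cV[R]_n | forall i, x i ord0 \in I i].

(* f is differentiable at x relative to X, with derivative y |-> J y. The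
   matrix J is unique as soon as X is rectangular without one-point factors;
   values of f outside X are irrelevant. *)
Definition has_jacobian_within (R : realType) (n : nat) (X : set 'cV[R]_n)
    (f : 'cV[R]_n -> 'cV[R]_n) (x : 'cV[R]_n) (J : 'M[R]_n) : Prop :=
  (fun y => f y - f x - J *m (y - x)) =o_ (within X (nbhs x)) (fun y => y - x).

(* The class D_d^+(X); the (i, i) entry of Dq is the partial derivative of q_i
   with respect to x_i. *)
Definition diagonal_increasing (R : realType) (n : nat) (X : set 'cV[R]_n)
    (q : 'cV[R]_n -> 'cV[R]_n) : Prop :=
  (exists phi : 'I_n -> R -> R,
     forall x, X x -> forall i, q x i ord0 = phi i (x i ord0)) /\
  (exists Dq : 'cV[R]_n -> 'M[R]_n,
     forall x, X x -> has_jacobian_within X q x (Dq x) /\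
                      (forall i, 0 < Dq x i i)).

(* Main.v *)
(*
Expand det (A' B') as the sum over injective maps phi (rows to columns) and
permutations s of (-1)^s prod_i A'(s i, phi i) B'(phi i, i). The sign of s and
the product both split over the orbits of s, and each orbit on which no factor
vanishes traces a cycle of the DSR graph, whose odd parity makes the
contribution of the orbit positive. Hence without e-cycles all terms of
det (T A B + E), for nonnegative diagonal T and E, are nonnegative, and
nondegeneracy supplies a nonzero one. Consequently -Df (or D - Df, for a
positive diagonal D) reverses the sign of no nonzero vector, i.e. it is a
P-matrix, and injectivity on a rectangle is the Gale-Nikaido theorem. In the
weakly nondegenerate case, e x - f x is injective for every e > 0; if f took
the same value at two points where Df is invertible, then for small e the map
e x - f x would take a common value near both.
*)
Require Import Defs.
From HB Require Import structures.
From mathcomp Require Import all_boot all_order all_algebra all_fingroup ring lra.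
From mathcomp Require Import all_classical all_reals all_analysis.
Import Order.TTheory GRing.Theory Num.Theory.
Import numFieldNormedType.Exports.
Local Open Scope classical_set_scope.
Local Open Scope ring_scope.
Set Implicit Arguments.
Unset Strict Implicit.
Unset Printing Implicit Defensive.

(** * Determinants and cycles of DSR graphs *)

Lemma cover_porbits (T : finType) (s : {perm T}) :
  finset.cover (porbits s) = finset.setT.
Proof.
apply/setP=> x; rewrite inE; apply/finset.bigcupP.
by exists (porbit s x); [exact: imset_f | exact: porbit_id].
Qed.

Lemma trivIset_porbits (T : finType) (s : {perm T}) :
  finset.trivIset (porbits s).
Proof.
apply/finset.trivIsetP => _ _ /imsetP[x _ ->] /imsetP[y _ ->] neq.
rewrite -setI_eq0; apply: contraNT neq => /finset.set0Pn[z] /setIP[].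
by rewrite -!eq_porbit_mem => /eqP <- /eqP <-.
Qed.

Lemma prod_porbits (R : comNzRingType) (T : finType) (s : {perm T}) (F : T -> R) :
  \prod_i F i = \prod_(C in porbits s) \prod_(i in C) F i.
Proof.
rewrite -finset.big_trivIset ?trivIset_porbits // cover_porbits.
by apply: eq_bigl => i; rewrite inE.
Qed.

(** The parity of [s] is that of [#|T|] plus the number of orbits; an orbit [C] adds [#|C|] to the
    first summand and 1 to the second. *)
Lemma sign_porbits (R : comNzRingType) (T : finType) (s : {perm T}) :
  (-1) ^+ s = \prod_(C in porbits s) (-1) ^+ #|C|.+1 :> R.
Proof.
rewrite -expr_sum -[RHS]signr_odd; congr (_ ^+ _).
congr (nat_of_bool _); rewrite /odd_perm (eq_bigr (fun C : {set T} => #|C| + 1)%N); last first.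
  by move=> C _; rewrite addn1.
rewrite big_split /= sum1_card oddD.
by rewrite (eqP (trivIset_porbits s)) cover_porbits cardsT.
Qed.

Lemma porbit_fixed (T : finType) (s : {perm T}) i : s i = i -> porbit s i = [set i]%SET.
Proof.
move=> si; apply/setP => j; rewrite inE.
apply/idP/eqP => [|->]; last exact: porbit_id.
case/porbitP => l ->; elim: l => [|l ih]; first by rewrite expg0 perm1.
by rewrite expgSr permM ih si.
Qed.

(** Cauchy-Binet, with maps in place of column subsets. For fixed [phi], the sum over [s] is a
    product of entries of [B] times a determinant that has two equal rows when [phi] is not
    injective. *)
Lemma det_mulmx_sum (R : comNzRingType) (n k : nat) (A : 'M[R]_(n, k))
    (B : 'M[R]_(k, n)) :
  \det (A *m B) =
  \sum_(phi : {ffun 'I_n -> 'I_k} | injectiveb phi) \sum_(s : 'S_n)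
    (-1) ^+ s * \prod_i (A (s i) (phi i) * B (phi i) i).
Proof.
have -> : \det (A *m B) = \sum_(phi : {ffun 'I_n -> 'I_k}) \sum_(s : 'S_n)
    (-1) ^+ s * \prod_i (A (s i) (phi i) * B (phi i) i).
  rewrite -det_tr /determinant exchange_big /=; apply: eq_bigr => s _.
  rewrite -mulr_sumr -(bigA_distr_bigA (fun i j => A (s i) j * B j i)).
  by congr (_ * _); apply: eq_bigr => i _; rewrite !mxE.
rewrite (bigID (fun phi : {ffun 'I_n -> 'I_k} => injectiveb phi)) /=.
rewrite [X in _ + X]big1 ?addr0 // => phi /injectivePn[i [j ij eq_phi]].
under eq_bigr => s _ do rewrite big_split mulrA /=.
rewrite -mulr_suml -[X in X * _](_ : \det (\matrix_(x, y) A y (phi x)) = _).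
  rewrite (determinant_alternate ij) ?mul0r // => x.
  by rewrite !mxE eq_phi.
by rewrite /determinant; apply: eq_bigr => s _; congr (_ * _);
   apply: eq_bigr => x _; rewrite mxE.
Qed.

Section Alternate.
Variables (I : Type) (T : eqType) (F G : I -> T).

(** A closed walk in a bipartite graph takes S-to-R and R-to-S steps in turn; this lists them in
    that order. *)
Definition alternate (s : seq I) : seq T := flatten [seq [:: F i; G i] | i <- s].

Lemma size_alternate s : size (alternate s) = (size s).*2.
Proof. by elim: s => //= i s ->. Qed.

Lemma perm_alternate s : perm_eq (alternate s) (map F s ++ map G s).
Proof.
elim: s => //= i s; rewrite perm_cons => ih.
by rewrite perm_sym -(cat1s (G i)) perm_catCA perm_cons perm_sym.
Qed.

End Alternate.

Lemma map_alternate (I : Type) (T U : eqType) (F G : I -> T) (h : T -> U) s :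
  map h (alternate F G s) = alternate (h \o F) (h \o G) s.
Proof. by elim: s => //= i s ->. Qed.

Lemma uniq_alternate (I T : eqType) (F G : I -> T) s :
  {in s &, injective F} -> {in s &, injective G} ->
  {in s &, forall i j, F i != G j} -> uniq s -> uniq (alternate F G s).
Proof.
move=> injF injG FG us.
rewrite (perm_uniq (perm_alternate F G s)) cat_uniq !map_inj_in_uniq // us andbT /=.
apply/hasPn => _ /mapP[j js ->]; apply/mapP => -[i is_ /eqP].
by rewrite eq_sym (negPf (FG i j is_ js)).
Qed.

(** * Cycles traced by the orbits of a permutation *)

Section Cycles.
Variables (R : realDomainType) (n m : nat) (A B : 'M[R]_(n, m)).

(** The edge that leaves S-vertex [i] for R-vertex [j], present when [B i j] is nonzero. It
    coincides with [RtoS_edge i j] exactly when [A i j * B i j] is positive, the undirected case. *)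
Definition StoR_edge i j : edge n m :=
  Edge i j (B i j < 0) (if 0 < A i j * B i j then Undirected else StoR).

Definition RtoS_edge i j : edge n m :=
  Edge i j (A i j < 0) (if 0 < A i j * B i j then Undirected else RtoS).

Lemma mem_StoR_edge i j : B i j != 0 -> StoR_edge i j \in dsr_graph A B.
Proof.
move=> b0; rewrite inE /= /dsr_labels (negPf b0).
have [->|a0] := eqVneq; first by rewrite mul0r ltxx mem_head.
case: ifP => ab; last by rewrite !inE eqxx orbT.
rewrite inE; apply/eqP; congr (_, _).
have [a|a|a] := ltgtP (A i j) 0; last by rewrite a eqxx in a0.
- by move: ab; rewrite nmulr_rgt0.
- by move: ab; rewrite pmulr_rgt0 // ltNge => /negbTE; rewrite le_eqVlt (negPf b0) /= => ->.
Qed.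

Lemma mem_RtoS_edge i j : A i j != 0 -> RtoS_edge i j \in dsr_graph A B.
Proof.
move=> a0; rewrite inE /= /dsr_labels (negPf a0).
have [->|b0] := eqVneq; first by rewrite mulr0 ltxx mem_head.
by case: ifP => ab; rewrite !inE eqxx.
Qed.

Lemma dsr_edge_StoR e :
  e \in dsr_graph A B -> has_StoR (dir e) -> B (svertex e) (rvertex e) != 0.
Proof.
rewrite inE /dsr_labels; case: eqVneq => [a0|a0]; case: eqVneq => [b0|b0] //=.
by rewrite inE => /eqP[_ ->].
Qed.

Lemma dsr_edge_RtoS e :
  e \in dsr_graph A B -> has_RtoS (dir e) -> A (svertex e) (rvertex e) != 0.
Proof.
rewrite inE /dsr_labels; case: eqVneq => [a0|a0]; case: eqVneq => [b0|b0] //=.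
by rewrite inE => /eqP[_ ->].
Qed.

(** A cycle is a path from its first step back to itself. Here the path starts one step later, at
    [G i], and ends at any [y] with the right source, a form stable under induction on [k]. *)
Lemma path_alternate (T : eqType) (src tgt : step n m -> T)
    (s : 'I_n -> 'I_n) (F G : 'I_n -> step n m) :
  (forall i, tgt (F i) = src (G i)) -> (forall i, tgt (G i) = src (F (s i))) ->
  forall k i y, src y = src (F (iter k.+1 s i)) ->
  path (fun p q => tgt p == src q) (G i)
       (rcons (alternate F G (traject s (s i) k)) y).
Proof.
move=> FG GF; elim=> [|k ih] i y srcy /=; first by rewrite srcy GF eqxx.
by rewrite GF FG !eqxx /=; apply: ih; rewrite srcy -iterSr.
Qed.

(* The orbit of i0 traces the cycle i0 -> psi i0 -> s i0 -> psi (s i0) -> ... *)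
Lemma orbit_term_gt0 (s : 'S_n) (psi : 'I_n -> 'I_m) (i0 : 'I_n) :
  ~ has_e_cycle (dsr_graph A B) -> {in porbit s i0 &, injective psi} ->
  {in porbit s i0, forall i, A (s i) (psi i) != 0 /\ B i (psi i) != 0} ->
  0 < (-1) ^+ #|porbit s i0|.+1 *
      \prod_(i in porbit s i0) (A (s i) (psi i) * B i (psi i)).
Proof.
set C := porbit s i0 => noe psi_inj nz.
(* [N] counts the negative factors, so the whole expression has the sign of
   [(-1) ^+ (#|C|.+1 + N)]. *)
pose N := (\sum_(i in C) ((A (s i) (psi i) < 0)%R + (B i (psi i) < 0)%R))%N.
have -> : \prod_(i in C) (A (s i) (psi i) * B i (psi i)) =
    (-1) ^+ N * \prod_(i in C) (`|A (s i) (psi i)| * `|B i (psi i)|).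
  rewrite /N expr_sum -big_split; apply: eq_bigr => i _ /=.
  rewrite exprD mulrACA; congr (_ * _).
  - by rewrite [LHS]realEsign ?num_real.
  - by rewrite [LHS]realEsign ?num_real.
rewrite mulrA -exprD addSn pmulr_lgt0; last first.
  by apply: prodr_gt0 => i /nz[a b]; rewrite mulr_gt0 ?normr_gt0.
(* If [#|C| + N] were even, the cycle of length [2 #|C|] traced by the orbit would have parity 1. *)
rewrite -signr_odd /=; case: (boolP (odd (#|C| + N))) => [//|even_kN].
case: noe.
pose F i : step n m := (StoR_edge i (psi i), true).
pose G i : step n m := (RtoS_edge (s i) (psi i), false).
pose t := traject s i0 #|C|.
have tC i : (i \in t) = (i \in C) by rewrite /C porbit_traject.
have ut : uniq t by exact: uniq_traject_porbit.
have [k kE] : exists k, #|C| = k.+1.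
  by case: #|C| (card_porbit_neq0 s i0) => // k _; exists k.
exists (alternate F G t); apply/andP; split; last first.
  rewrite /cycle_parity size_alternate doubleK size_traject /cycle_sign.
  rewrite (perm_big _ (perm_alternate F G t)) big_cat !big_map /=.
  rewrite -big_split /= big_uniq //=.
  rewrite (eq_bigl _ _ tC) (eq_bigr (fun i =>
    (-1) ^+ ((A (s i) (psi i) < 0)%R + (B i (psi i) < 0)%R))); last first.
    by move=> i _; rewrite /edge_sign /= mulrC exprD.
  by rewrite -expr_sum -exprD -signr_odd (negPf even_kN).
(* An edge can occur twice only if the orbit is a fixed point and the edge undirected; then both
   factors have the same sign, [N] is even and [#|C| + N] is odd, against [even_kN]. *)
have FGs i j : i \in C -> j \in C -> StoR_edge i (psi i) != RtoS_edge (s j) (psi j).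
  move=> iC jC; apply/eqP => -[isj eq_psi neg _].
  have ij := psi_inj i j iC jC eq_psi; subst j.
  have CE : C = [set i]%SET.
    have /eqP <- : porbit s i == C by rewrite eq_porbit_mem.
    by rewrite porbit_fixed.
  move: even_kN; rewrite /N CE cards1 big_set1 neg -isj.
  by case: (A i (psi i) < 0).
apply/and5P; split.
- by rewrite -size_eq0 size_alternate size_traject kE.
- rewrite (perm_all _ (perm_alternate F G t)) all_cat !all_map.
  apply/andP; split; apply/allP => i; rewrite tC => /nz[a b] /=.
  + by rewrite mem_StoR_edge // /step_allowed /=; case: ifP.
  + by rewrite mem_RtoS_edge // /step_allowed /=; case: ifP.
- rewrite /t kE /= eqxx /=.
  by apply: path_alternate => //; rewrite -kE iter_porbit.
- rewrite map_alternate; apply: uniq_alternate => // i j; rewrite !tC => iC jC /=.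
  + by rewrite /step_source /=; case.
  + by rewrite /step_source /= => -[] /(psi_inj i j iC jC).
- rewrite map_alternate; apply: uniq_alternate => // i j; rewrite !tC /=.
  + by move=> _ _ [].
  + by move=> iC jC [_ /(psi_inj i j iC jC)].
  + exact: FGs.
Qed.

End Cycles.

(** * Positivity of determinants *)

Section Determinant.
Variables (R : realDomainType) (n m : nat) (A : 'M[R]_(n, m)) (B : 'M[R]_(m, n)).

(* diag t A B + diag e = [diag t A, diag e] [B; 1]: the extra columns act as
   private R-vertices of the rows, so they create no new cycle. *)
Lemma dsr_term_ge0 (t e : 'rV[R]_n) (phi : 'I_n -> 'I_(m + n)) (s : 'S_n) :
  ~ has_e_cycle (dsr_graph A B^T) ->
  (forall i, 0 <= t 0 i) -> (forall i, 0 <= e 0 i) -> injective phi ->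
  0 <= (-1) ^+ s * \prod_i (row_mx (diag_mx t *m A) (diag_mx e) (s i) (phi i) *
                            col_mx B 1%:M (phi i) i).
Proof.
move=> noe t0 e0 phi_inj; 
pose F i := row_mx (diag_mx t *m A) (diag_mx e) (s i) (phi i) * col_mx B 1%:M (phi i) i.
rewrite -/(\prod_i F i).
rewrite sign_porbits (prod_porbits s F) -big_split /=.
apply: prodr_ge0 => _ /imsetP[i0 _ ->].
have [/existsP[i /andP[iC /eqP Fi]]|/existsPn nz] :=
    boolP [exists i, (i \in porbit s i0) && (F i == 0)].
  by rewrite (bigD1 i) //= Fi mul0r mulr0.
have {}nz i : i \in porbit s i0 -> F i != 0.
  by move=> iC; have := nz i; rewrite iC.
(* A nonzero factor in a private column [k] forces [s i = k = i]; the orbit is then a singleton and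
   contributes an entry of [e]. *)
have [/existsP[i /andP[iC /existsP[k /eqP ik]]]|/existsPn left] := boolP
    [exists i, (i \in porbit s i0) && [exists k, phi i == rshift m k]].
  have := nz i iC; rewrite /F ik row_mxEr col_mxEd !mxE.
  case: (eqVneq (s i) k) => [ski|]; last by rewrite mulr0n mul0r eqxx.
  case: (eqVneq k i) => [ki|]; last by rewrite mulr0n mulr0 eqxx.
  move=> _; have si : s i = i by rewrite ski.
  have /eqP <- : porbit s i == porbit s i0 by rewrite eq_porbit_mem.
  rewrite (porbit_fixed si) cards1 big_set1 sqrrN expr1n mul1r /F.
  by rewrite si ik row_mxEr col_mxEd !mxE ki eqxx mulr1 mulr1n.
have {}left i : i \in porbit s i0 -> exists j, phi i = lshift n j.
  move=> iC; case: (fintype.splitP (phi i)) => [j ij|k ik].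
    by exists j; apply: val_inj.
  have := left i; rewrite iC /= => /existsPn/(_ k)/eqP; case.
  exact: val_inj.
have [j0 _] := left i0 (porbit_id s i0).
(* On the orbit [phi] only takes columns of [A]; [j0] is a dummy value for other indices. *)
pose psi i := if fintype.split (phi i) is inl j then j else j0.
have psiE i : i \in porbit s i0 -> phi i = lshift n (psi i).
  move=> /left[j ij]; rewrite /psi ij.
  case: fintype.splitP => [j' /= jj'|k /= jk]; first exact: val_inj.
  by have := ltn_ord j; rewrite jk ltnNge leq_addr.
rewrite (eq_bigr (fun i => t 0 (s i) * (A (s i) (psi i) * B^T i (psi i)))); last first.
  by move=> i iC; rewrite /F psiE // row_mxEl col_mxEu mul_diag_mx !mxE mulrA.
rewrite big_split mulrCA mulr_ge0 ?prodr_ge0 //= ltW // orbit_term_gt0 //.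
  by move=> i j iC jC ij; apply: phi_inj; rewrite !psiE // ij.
move=> i iC; have := nz i iC.
rewrite /F psiE // row_mxEl col_mxEu mul_diag_mx !mxE !mulf_eq0 !negb_or.
by case/andP => /andP[].
Qed.

(** All terms of the expansion are nonnegative, so the single nonvanishing one given by [phi] and
    [s] makes the sum positive. *)
Lemma dsr_det_gt0_of_term (t e : 'rV[R]_n) (phi : 'I_n -> 'I_(m + n)) (s : 'S_n) :
  ~ has_e_cycle (dsr_graph A B^T) ->
  (forall i, 0 <= t 0 i) -> (forall i, 0 <= e 0 i) -> injective phi ->
  (forall i, row_mx (diag_mx t *m A) (diag_mx e) (s i) (phi i) != 0) ->
  (forall i, col_mx B 1%:M (phi i) i != 0) ->
  0 < \det (diag_mx t *m A *m B + diag_mx e).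
Proof.
move=> noe t0 e0 phi_inj nzA nzB.
rewrite -[diag_mx e]mulmx1 -mul_row_col det_mulmx_sum.
have ge0 (phi' : {ffun 'I_n -> 'I_(m + n)}) (s' : 'S_n) : injectiveb phi' ->
    0 <= (-1) ^+ s' * \prod_i (row_mx (diag_mx t *m A) (diag_mx e) (s' i) (phi' i) *
                            col_mx B 1%:M (phi' i) i).
  by move=> /injectiveP; exact: dsr_term_ge0.
have phi_injb : injectiveb (finfun phi).
  by apply/injectiveP => i j; rewrite !ffunE => /phi_inj.
rewrite (bigD1 (finfun phi)) //= (bigD1 s) //= -addrA ltr_wpDr //.
  apply: addr_ge0; first by apply: sumr_ge0 => s' _; apply: ge0.
  by apply: sumr_ge0 => phi' /andP[inj _]; apply: sumr_ge0 => s' _; apply: ge0.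
rewrite lt_def ge0 // andbT mulf_eq0 signr_eq0 /= prodf_seq_neq0.
by apply/allP => i _ /=; rewrite ffunE mulf_eq0 negb_or nzA nzB.
Qed.

(** The matching becomes an injection of all rows into the columns of [[diag t A, diag e]]: rows
    outside [gamma] go to their private columns. The last clause, surjectivity onto [delta], allows
    two matchings on the same columns to be compared. *)
Lemma term_subgraph_matching (G : dsr n m) gamma delta T :
  term_subgraph G gamma delta T ->
  exists alpha : 'I_n -> 'I_(m + n),
    [/\ injective alpha,
        {in gamma, forall i, exists2 e, e \in T &
          [/\ svertex e = i, rvertex e \in delta & alpha i = lshift n (rvertex e)]},
        forall i, i \notin gamma -> alpha i = rshift m i
      & {in delta, forall j, exists2 i, i \in gamma & alpha i = lshift n j}].
Proof.
case/and3P => /fintype.subsetP TG /forall_inP rowT /forall_inP colT.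
have Tsub e : e \in T -> (svertex e \in gamma) && (rvertex e \in delta).
  by move=> /TG; rewrite inE => /andP[].
have rowP i e e' : i \in gamma -> e \in T -> e' \in T ->
    svertex e = i -> svertex e' = i -> e = e'.
  move=> /rowT/cards1P[x Tx] eT e'T ei e'i.
  have : e \in [set x]%SET by rewrite -Tx inE eT ei eqxx.
  have : e' \in [set x]%SET by rewrite -Tx inE e'T e'i eqxx.
  by rewrite !inE => /eqP -> /eqP ->.
have colP j e e' : j \in delta -> e \in T -> e' \in T ->
    rvertex e = j -> rvertex e' = j -> e = e'.
  move=> /colT/cards1P[x Tx] eT e'T ej e'j.
  have : e \in [set x]%SET by rewrite -Tx inE eT ej eqxx.
  have : e' \in [set x]%SET by rewrite -Tx inE e'T e'j eqxx.
  by rewrite !inE => /eqP -> /eqP ->.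
pose alpha i :=
  if [pick e in T | svertex e == i] is Some e then lshift n (rvertex e) else rshift m i.
have alphaT e : e \in T -> alpha (svertex e) = lshift n (rvertex e).
  move=> eT; rewrite /alpha; case: pickP => [e' /andP[e'T /eqP ee']|/(_ e)]; last by rewrite eT eqxx.
  by have /andP[ig _] := Tsub e eT; rewrite (rowP (svertex e) e e').
have alphaN i : i \notin gamma -> alpha i = rshift m i.
  rewrite /alpha; case: pickP => [e /andP[/Tsub/andP[eg _] /eqP ei]|//].
  by rewrite -ei eg.
have alphaY i : i \in gamma -> exists2 e, e \in T &
    [/\ svertex e = i, rvertex e \in delta & alpha i = lshift n (rvertex e)].
  move=> /rowT/cards1P[e Te]; have := set11 e; rewrite -Te inE => /andP[eT /eqP ei].
  by exists e => //; have /andP[_ ed] := Tsub e eT; split=> //; rewrite -ei alphaT.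
exists alpha; split=> //.
- move=> i j; have [ig|ig] := boolP (i \in gamma); have [jg|jg] := boolP (j \in gamma).
  + have [e eT [<- ed ->]] := alphaY i ig; have [e' e'T [<- e'd ->]] := alphaY j jg.
    by move=> /lshift_inj ee'; rewrite (colP (rvertex e) e e').
  + have [e eT [<- ed ->]] := alphaY i ig; rewrite (alphaN j) // => /eqP.
    by rewrite eq_lrshift.
  + have [e eT [<- ed ->]] := alphaY j jg; rewrite (alphaN i) // => /eqP.
    by rewrite eq_rlshift.
  + by rewrite !alphaN // => /rshift_inj.
- move=> j /colT/cards1P[e Te]; have := set11 e; rewrite -Te inE => /andP[eT /eqP ej].
  by exists (svertex e); [have /andP[] := Tsub e eT | rewrite alphaT // ej].
Qed.

(** The R-to-S matching [alpha] picks nonzero entries of [A], the S-to-R matching [beta] nonzero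
    entries of [B]. They have the same image, so [sigma = alpha^-1 beta] is a permutation, and the
    term of [beta] and [sigma] does not vanish. *)
Lemma dsr_det_gt0 (gamma : {set 'I_n}) (t e : 'rV[R]_n) :
  ~ has_e_cycle (dsr_graph A B^T) ->
  (forall i, 0 <= t 0 i) -> (forall i, 0 <= e 0 i) ->
  (forall i, i \in gamma -> 0 < t 0 i) -> (forall i, i \notin gamma -> 0 < e 0 i) ->
  (gamma != finset.set0 ->
   exists delta, dsr_weakly_nondegenerate_sub (dsr_graph A B^T) gamma delta) ->
  0 < \det (diag_mx t *m A *m B + diag_mx e).
Proof.
move=> noe t0 e0 tg eg wnd.
have [delta [[TS [TSterm TSdir]] [TR [TRterm TRdir]]]] : exists delta : {set 'I_m},
    let G := dsr_graph A B^T in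
    (exists T : dsr n m, term_subgraph G gamma delta T /\ {in T, forall e, has_StoR (dir e)}) /\
    (exists T : dsr n m, term_subgraph G gamma delta T /\ {in T, forall e, has_RtoS (dir e)}).
  (* For empty [gamma] the empty subgraph serves as both matchings. *)
  have [->|/wnd[delta0 [delta [_ _ TS TR]]]] := eqVneq gamma finset.set0; last by exists delta.
  have empty : term_subgraph (dsr_graph A B^T) finset.set0 finset.set0 finset.set0.
    apply/and3P; split; first exact: finset.sub0set.
    - by apply/forall_inP => i; rewrite inE.
    - by apply/forall_inP => j; rewrite inE.
  by exists finset.set0 => G; split; exists finset.set0; split=> // x; rewrite inE.
have [alpha [alpha_inj alphaY alphaN alphaS]] := term_subgraph_matching TRterm.
have [beta [beta_inj betaY betaN _]] := term_subgraph_matching TSterm.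
have ex i : exists j, alpha j == beta i.
  have [ig|ig] := boolP (i \in gamma); last by exists i; rewrite betaN // alphaN.
  have [e' _ [_ e'd ->]] := betaY i ig; have [j _ jE] := alphaS _ e'd.
  by exists j; rewrite jE.
pose sigma i := xchoose (ex i).
have sigmaE i : alpha (sigma i) = beta i by apply/eqP; exact: (xchooseP (ex i)).
have sigma_inj : injective sigma.
  by move=> i j ij; apply: beta_inj; rewrite -!sigmaE ij.
have TG dl T x : term_subgraph (dsr_graph A B^T) gamma dl T -> x \in T -> x \in dsr_graph A B^T.
  by case/and3P => /fintype.subsetP sub _ _ /sub; rewrite inE => /andP[].
apply: (@dsr_det_gt0_of_term t e beta (perm sigma_inj)) => // i.
- rewrite permE -sigmaE; move: (sigma i) => {}i.
  have [ig|ig] := boolP (i \in gamma); last first.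
    by rewrite alphaN // row_mxEr mxE eqxx mulr1n gt_eqF // eg.
  have [x xT [xi xd ->]] := alphaY i ig.
  rewrite row_mxEl mul_diag_mx mxE; apply: mulf_neq0; first by rewrite gt_eqF ?tg.
  by rewrite -xi; apply: (dsr_edge_RtoS (TG _ _ _ TRterm xT)); exact: TRdir.
- have [ig|ig] := boolP (i \in gamma); last first.
    by rewrite betaN // col_mxEd mxE eqxx oner_neq0.
  have [x xT [xi xd ->]] := betaY i ig.
  have := dsr_edge_StoR (TG _ _ _ TSterm xT) (TSdir x xT).
  by rewrite col_mxEu mxE xi.
Qed.

End Determinant.

(** * Matrices reversing no sign *)

(* By a theorem of Fiedler and Ptak, these are exactly the P-matrices. *)
Definition sign_nonreversing (R : realFieldType) (n : nat) (M : 'M[R]_n) : Prop :=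
  forall u : 'cV[R]_n, (forall i, u i ord0 * (M *m u) i ord0 <= 0) -> u = 0.

Lemma diag_mulmxE (R : comNzRingType) (n p : nat) (d : 'rV[R]_n) (N : 'M[R]_(n, p)) i j :
  (diag_mx d *m N) i j = d 0 i * N i j.
Proof. by rewrite mul_diag_mx mxE. Qed.

Section SignNonreversing.
Variables (R : realFieldType) (n : nat).
Implicit Types (M : 'M[R]_n) (t d : 'rV[R]_n) (u : 'cV[R]_n).

(** With [x = u] and [y = M u], choose [t] coordinatewise so that [t y + (1 - t) x = 0]; then [u]
    lies in the kernel of [T M + (1 - T)]. *)
Lemma reversed_det0 M u :
  u != 0 -> (forall i, u i ord0 * (M *m u) i ord0 <= 0) ->
  exists t, [/\ forall i, 0 <= t 0 i <= 1
              & \det (diag_mx t *m M + diag_mx (const_mx 1 - t)) = 0].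
Proof.
move=> u0 rev; pose x i := u i ord0; pose y i := (M *m u) i ord0.
(* Where [x i = 0], the convention on division by zero gives [t i = 0], and the equation still
   holds. *)
pose t : 'rV[R]_n := \row_i (x i ^+ 2 / (x i ^+ 2 - x i * y i)).
have den i : x i != 0 -> 0 < x i ^+ 2 - x i * y i.
  by move=> xi; rewrite subr_gt0 (le_lt_trans (rev i)) // exprn_even_gt0.
exists t; split=> [i|].
  rewrite mxE; have [->|xi] := eqVneq (x i) 0; first by rewrite expr0n mul0r lexx ler01.
  rewrite divr_ge0 ?sqr_ge0 ?(ltW (den i xi)) //= ler_pdivrMr ?den // mul1r.
  by rewrite lerDl oppr_ge0; exact: rev.
apply/eqP; rewrite -det_tr; apply/det0P; exists u^T.
  by apply: contra u0 => /eqP/(congr1 trmx); rewrite trmxK trmx0 => ->.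
rewrite -trmx_mul; apply/eqP; rewrite -trmx0 (inj_eq trmx_inj); apply/eqP/colP => i.
rewrite mulmxDl -mulmxA [LHS]mxE !diag_mulmxE !mxE -/(x i).
rewrite [X in _ * X + _](_ : _ = y i); last by rewrite /y mxE.
have [xi|xi] := eqVneq (x i) 0; first by rewrite xi expr0n !mul0r mulr0 addr0.
have := den i xi => /lt0r_neq0 ?; field. 
by [].
Qed.

Lemma sign_nonreversing_of_det M :
  (forall t, (forall i, 0 <= t 0 i <= 1) ->
     \det (diag_mx t *m M + diag_mx (const_mx 1 - t)) != 0) ->
  sign_nonreversing M.
Proof.
move=> detM u rev; apply/eqP; apply: contraT => /reversed_det0/(_ rev)[t [t01 d0]].
by have := detM t t01; rewrite d0 eqxx.
Qed.

(* Sylvester: det (T M^T + (1 - T)) = 0 yields a vector v killed by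
   M T + (1 - T), and T v is then reversed by M. *)
Lemma sign_nonreversing_tr M : sign_nonreversing M -> sign_nonreversing M^T.
Proof.
move=> nrM u rev; apply/eqP; apply: contraT => /reversed_det0/(_ rev)[t [t01 /eqP/det0P[v v0]]].
move=> /(congr1 trmx); rewrite trmx0 trmx_mul linearD /= trmx_mul trmxK !tr_diag_mx => Mv.
case/negP: v0; pose w := v^T; pose Tw := diag_mx t *m w.
(* Multiplying [M T w + (1 - T) w = 0] by [T] shows that [M] reverses [T w]; once [T w = 0], the
   equation itself gives [w = 0]. *)
have Tw_eq i : t 0 i * (M *m Tw) i ord0 = - (1 - t 0 i) * Tw i ord0.
  have : (diag_mx t *m ((M *m diag_mx t + diag_mx (const_mx 1 - t)) *m w)) i ord0 = 0.
    by rewrite Mv mulmx0 mxE.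
  rewrite mulmxDl -(mulmxA M) -/Tw diag_mulmxE [X in _ * X]mxE mulrDr diag_mulmxE.
  rewrite [Tw i _]diag_mulmxE [(const_mx 1 - t) _ _]mxE [const_mx _ _ _]mxE [(- t) _ _]mxE.
  by move=> /eqP; rewrite addr_eq0 => /eqP ->; ring.
have Tw0 : Tw = 0.
  apply: nrM => i; have /andP[t0 t1] := t01 i.
  have [ti|ti] := eqVneq (t 0 i) 0; first by rewrite [Tw i _]diag_mulmxE ti !mul0r.
  have tpos : 0 < t 0 i by rewrite lt_def ti.
  rewrite -(pmulr_rle0 _ tpos) mulrCA Tw_eq mulrCA -expr2 mulNr oppr_le0.
  by rewrite mulr_ge0 ?sqr_ge0 // subr_ge0.
have : w = 0.
  move: Mv; rewrite mulmxDl -mulmxA -/w -/Tw Tw0 mulmx0 add0r.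
  rewrite linearB /= diag_const_mx mulmxBl mul1mx -/Tw Tw0 subr0; exact.
by move=> /(congr1 trmx); rewrite trmxK trmx0 => ->.
Qed.

(** Write [S] for [diag_mx s]. If the conjugate reverses [u], then [M] reverses [S u], so [S u = 0]
    and [u] vanishes where [s] does not. Where [s] vanishes, the added diagonal entry 1 forces
    [u i = 0]. *)
Lemma sign_nonreversing_conj M (s : 'rV[R]_n) :
  sign_nonreversing M -> (forall i, s 0 i \in [:: 0; 1; -1]) ->
  sign_nonreversing (diag_mx s *m M *m diag_mx s + diag_mx (\row_i (1 - s 0 i ^+ 2))).
Proof.
move=> nrM s01 u rev.
have entry i : ((diag_mx s *m M *m diag_mx s + diag_mx (\row_i (1 - s 0 i ^+ 2))) *m u) i ord0 =
    s 0 i * (M *m (diag_mx s *m u)) i ord0 + (1 - s 0 i ^+ 2) * u i ord0.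
  rewrite mulmxDl -!mulmxA mxE !diag_mulmxE.
  by congr (_ + _ * _); rewrite mxE.
have su0 : diag_mx s *m u = 0.
  apply: nrM => i; have := rev i; rewrite entry.
  rewrite [(diag_mx s *m u) i _]diag_mulmxE; set y := (M *m _) i _.
  have := s01 i; rewrite !inE => /or3P[] /eqP ->; first by rewrite !mul0r.
    by rewrite expr1n subrr mul0r addr0 !mul1r.
  by rewrite sqrrN expr1n subrr mul0r addr0 !mulN1r mulrN mulNr.
apply/colP => i; have := rev i; rewrite entry su0 mulmx0 !mxE mulr0 add0r.
have := congr1 (fun z : 'cV[R]_n => z i ord0) su0; rewrite diag_mulmxE mxE.
have := s01 i; rewrite !inE => /or3P[] /eqP ->.
- move=> _; rewrite expr0n subr0 mul1r -expr2 => ui; apply/eqP.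
  by rewrite -sqrf_eq0 eq_le ui sqr_ge0.
- by rewrite mul1r.
- by rewrite mulN1r => /eqP; rewrite oppr_eq0 => /eqP.
Qed.

End SignNonreversing.

Section FactorNonreversing.
Variables (R : realFieldType) (n m : nat) (A : 'M[R]_(n, m)) (B : 'M[R]_(m, n)).

(** The matrix [T (A B + D) + (1 - T)] equals [T A B + E] with [E = T D + 1 - T]. The zero set of
    [E] is taken as [gamma]; on it [t i = 1] and [d i = 0]. *)
Lemma dsr_sign_nonreversing (d : 'rV[R]_n) :
  ~ has_e_cycle (dsr_graph A B^T) -> (forall i, 0 <= d 0 i) ->
  (forall gamma : {set 'I_n}, gamma != finset.set0 ->
     (forall i, i \in gamma -> d 0 i = 0) ->
     exists delta, dsr_weakly_nondegenerate_sub (dsr_graph A B^T) gamma delta) ->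
  sign_nonreversing (A *m B + diag_mx d).
Proof.
move=> noe d0 wnd; apply: sign_nonreversing_of_det => t t01.
pose e : 'rV[R]_n := \row_i (t 0 i * d 0 i + (1 - t 0 i)).
have -> : diag_mx t *m (A *m B + diag_mx d) + diag_mx (const_mx 1 - t) =
          diag_mx t *m A *m B + diag_mx e.
  rewrite mulmxDr mulmxA -addrA; congr (_ + _).
  apply/matrixP => i j; rewrite mul_diag_mx !mxE mulrnAr -mulrnDl.
  by [].
have t0 i : 0 <= t 0 i by have /andP[] := t01 i.
have t1 i : 0 <= 1 - t 0 i by rewrite subr_ge0; have /andP[] := t01 i.
have e0 i : 0 <= e 0 i by rewrite mxE addr_ge0 ?mulr_ge0.
rewrite gt_eqF //; apply: (@dsr_det_gt0 _ _ _ _ _ [set i | e 0 i == 0]%SET) => //.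
- move=> i; rewrite inE mxE paddr_eq0 ?mulr_ge0 // => /andP[_].
  by rewrite subr_eq0 => /eqP <-; rewrite ltr01.
- by move=> i; rewrite inE lt_def => ->; rewrite e0.
- move=> /wnd; apply => i; rewrite inE mxE paddr_eq0 ?mulr_ge0 // => /andP[td].
  by rewrite subr_eq0 => /eqP t1i; move: td; rewrite -t1i mul1r => /eqP.
Qed.

Lemma dsr_det_mulmx_gt0 :
  ~ has_e_cycle (dsr_graph A B^T) -> dsr_weakly_nondegenerate (dsr_graph A B^T) ->
  0 < \det (A *m B).
Proof.
move=> noe wnd.
have -> : A *m B = diag_mx (const_mx 1) *m A *m B + diag_mx 0.
  by rewrite diag_const_mx mul1mx raddf0 addr0.
apply: (@dsr_det_gt0 _ _ _ _ _ finset.setT) => //; try by move=> i; rewrite !mxE.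
- by move=> i; rewrite inE.
- by exists finset.setT.
Qed.

End FactorNonreversing.

(** * Topology of column vectors *)

Lemma finite_lower_bound (R : realFieldType) (I : finType) (a : I -> R) :
  (forall i, 0 < a i) -> exists2 d, 0 < d & forall i, d <= a i.
Proof.
(* The extra 1 gives a positive bound also when [I] is empty. *)
move=> a0; exists (\big[Order.min/1]_i a i); first by apply: lt_bigmin => // i _.
by move=> i; exact: bigmin_le.
Qed.

Section ColumnVectors.
Variables (R : realType) (n : nat).
Implicit Types (u : 'cV[R]_n) (K X : set 'cV[R]_n).

Lemma cV_norm_le u (r : R) :
  0 <= r -> (forall i, `|u i ord0| <= r) -> `|u| <= r.
Proof.
move=> r0 ur; rewrite [leLHS]/Num.norm /= mx_normrE; apply/bigmax_leP; split=> //= -[i j] _ /=.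
by rewrite (ord1 j).
Qed.

Lemma cV_coord_le u i : `|u i ord0| <= `|u|.
Proof.
rewrite [leRHS]/Num.norm /= mx_normrE; apply/bigmax_geP; right => /=.
by exists (i, ord0).
Qed.

Lemma mulmx_norm_le (M : 'M[R]_n) :
  exists2 C, 0 < C & forall u, `|M *m u| <= C * `|u|.
Proof.
exists (1 + \sum_i \sum_j `|M i j|).
  by rewrite ltr_wpDr ?ltr01 // sumr_ge0 // => i _; exact: sumr_ge0.
move=> u; apply: cV_norm_le => [|i].
  by rewrite mulr_ge0 // addr_ge0 ?ler01 // sumr_ge0 // => i _; exact: sumr_ge0.
rewrite mxE (le_trans (ler_norm_sum _ _ _)) //.
apply: (@le_trans _ _ ((\sum_j `|M i j|) * `|u|)).
  rewrite mulr_suml; apply: ler_sum => j _; rewrite normrM.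
  by rewrite ler_wpM2l ?cV_coord_le.
rewrite ler_wpM2r // [X in _ <= 1 + X](bigD1 i) //= addrCA lerDl addr_ge0 ?ler01 //.
by apply: sumr_ge0 => k _; exact: sumr_ge0.
Qed.

Lemma trmx_continuous (p q : nat) : continuous (fun v : 'M[R]_(p, q) => v^T).
Proof.
move=> v U /nbhs_ballP[e e0 eU]; apply/nbhs_ballP; exists e => //= w vw.
by apply: eU; case: vw => _ vw; split=> // i j; rewrite !mxE; exact: vw.
Qed.

(** Heine-Borel, carried over from row vectors by transposition. *)
Lemma cV_compact K : bounded_set K -> closed K -> compact K.
Proof.
move=> [M [Mreal KM]] Kcl.
have -> : K = (fun v : 'rV[R]_n => v^T) @` [set v : 'rV[R]_n | K v^T].
  rewrite eqEsubset; split=> [v Kv|_ [v Kv <-] //].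
  by exists v^T; rewrite /= ?trmxK.
apply: continuous_compact; first exact/continuous_subspaceT/trmx_continuous.
apply: bounded_closed_compact.
  exists M; split=> // r Mr v /= /(KM r Mr) /=.
  apply: le_trans; rewrite [leLHS]/Num.norm [leRHS]/Num.norm /= !mx_normrE.
  apply/bigmax_leP; split=> [|[i j] _ /=]; first exact: bigmax_ge_id.
  by have := le_bigmax 0 (fun ij => `|v^T ij.1 ij.2|) (j, i); rewrite /= mxE.
by have /continuous_closedP := @trmx_continuous 1 n; apply.
Qed.

Lemma cV_argmin K (g : 'cV[R]_n -> R) :
  K !=set0 -> bounded_set K -> closed K -> {within K, continuous g} ->
  exists2 c, K c & forall x, K x -> g c <= g x.
Proof.
move=> K0 Kb Kc cg; have [c cK gc] := compact_EVT_min K0 (cV_compact Kb Kc) cg.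
exists c; first by move: cK; rewrite inE.
by move=> x Kx; apply: gc; rewrite inE.
Qed.

Lemma within_continuous_of_dist K (g : 'cV[R]_n -> R) :
  (forall x, K x -> forall e, 0 < e ->
     exists2 d, 0 < d & forall y, K y -> `|y - x| < d -> `|g y - g x| < e) ->
  {within K, continuous g}.
Proof.
move=> cg; apply/subspace_continuousP => x Kx U /nbhs_normP[e e0 eU].
have [d d0 dg] := cg x Kx e e0.
change (\forall y \near x, K y -> U (g y)).
apply/nbhs_normP; exists d => //= y; rewrite /ball_ /= distrC => yx Ky.
by apply: eU; rewrite /ball_ /= distrC dg.
Qed.

Lemma closed_of_dist K :
  (forall x, ~ K x -> exists2 d, 0 < d & forall y, `|y - x| < d -> ~ K y) ->
  closed K.
Proof.
move=> Kc x clx; apply: contrapT => /Kc[d d0 dK].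
have /clx[y [Ky /dK]] : \forall y \near x, `|y - x| < d.
  by apply/nbhs_normP; exists d => //= y; rewrite /ball_ /= distrC.
by [].
Qed.

Lemma jacobian_dist X f x J : has_jacobian_within X f x J ->
  forall e : R, 0 < e -> exists2 d, 0 < d &
    forall y, X y -> `|y - x| < d -> `|f y - f x - J *m (y - x)| <= e * `|y - x|.
Proof.
move=> /eqoP fJ e e0; have /nbhs_normP[d d0 dX] := fJ e e0.
by exists d => // y Xy yx; apply: (dX y) => //; rewrite /ball_ /= distrC.
Qed.

Lemma jacobian_of_dist X f x (J : 'M[R]_n) :
  (forall e : R, 0 < e -> exists2 d, 0 < d &
    forall y, X y -> `|y - x| < d -> `|f y - f x - J *m (y - x)| <= e * `|y - x|) ->
  has_jacobian_within X f x J.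
Proof.
move=> fJ; apply/eqoP => e e0; have [d d0 dX] := fJ e e0.
change (\forall y \near x, X y -> `|f y - f x - J *m (y - x)| <= e * `|y - x|).
apply/nbhs_normP; exists d => //= y; rewrite /ball_ /= distrC => yx Xy.
exact: dX.
Qed.

End ColumnVectors.

Lemma sum_continuous (R : realType) (T : topologicalType) (I : Type) (r : seq I)
    (F : I -> T -> R) :
  (forall i, continuous (F i)) -> continuous (fun x => \sum_(i <- r) F i x).
Proof. by move=> cF; apply: continuous_big => // x; exact: add_continuous. Qed.

Lemma simplex_argmin (R : realType) (n : nat) (g : 'cV[R]_n.+1 -> R) :
  continuous g ->
  let K := [set v : 'cV[R]_n.+1 | (forall i, 0 <= v i ord0) /\ \sum_i v i ord0 = 1] in
  exists2 v, K v & forall w, K w -> g v <= g w.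
Proof.
move=> cg K; apply: cV_argmin.
- exists (delta_mx ord0 ord0); split=> [i|].
    by rewrite mxE ler0n.
  rewrite (bigD1 ord0) //= mxE eqxx big1 => [|i /negPf i0]; last by rewrite mxE i0.
  by rewrite addr0.
- exists 1; split; first exact: num_real.
  move=> r r1 v [v0 v1]; apply: (@le_trans _ _ 1); last exact: ltW.
  apply: cV_norm_le => // i; rewrite ger0_norm // -v1 (bigD1 i) //= lerDl.
  by apply: sumr_ge0.
- have -> : K = (\bigcap_(i in [set: 'I_n.+1]) ((fun v : 'cV[R]_n.+1 => v i ord0) @^-1` [set x | 0 <= x]))
      `&` ((fun v : 'cV[R]_n.+1 => \sum_i v i ord0) @^-1` [set x | x = 1]).
    rewrite eqEsubset; split=> v [v0 v1]; split=> // i; first by move=> _; exact: v0.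
    exact: (v0 i).
  apply: closedI; first apply: closed_bigI => i _.
    by apply: preimage_closed (@closed_ge _ _) => v _; exact: coord_continuous.
  apply: preimage_closed (@closed_eq _ _) => v _; apply: sum_continuous => i.
  exact: coord_continuous.
- exact: continuous_subspaceT.
Qed.

(* The first-order condition at a minimiser v of sum_j (max ((M^T v)_j, 0))^2
   over the simplex says that p = max (M^T v, 0) satisfies M p >= |p|^2, and
   p is not 0 since M^T does not reverse v. *)
Lemma sign_nonreversing_pos (R : realType) (n : nat) (M : 'M[R]_n) :
  sign_nonreversing M ->
  exists2 p : 'cV[R]_n, forall i, 0 < p i ord0 & forall i, 0 < (M *m p) i ord0.
Proof.
case: n M => [|n] M nrM; first by exists 0 => -[].
pose y (v : 'cV[R]_n.+1) j := \sum_i M i j * v i ord0.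
pose g v := \sum_j (Num.max (y v j) 0) ^+ 2.
have cg : continuous g.
  apply: sum_continuous => j; have cy : continuous (fun v => Num.max (y v j) 0).
    move=> v; apply: continuous_max; last exact: cst_continuous.
    apply: sum_continuous => i {}v.
    by apply: continuousM; [exact: cst_continuous | exact: coord_continuous].
  by move=> v; exact: (continuousM (cy v) (cy v)).
have [v [v0 v1] vmin] := simplex_argmin cg.
pose p := \col_j Num.max (y v j) 0.
have pE j : p j ord0 = Num.max (y v j) 0 by rewrite mxE.
have p0 j : 0 <= p j ord0 by rewrite pE le_max lexx orbT.
have gv : g v = \sum_j p j ord0 ^+ 2 by apply: eq_bigr => j _; rewrite pE.
have g0 : 0 < g v.
  rewrite lt_def sumr_ge0 ?andbT => [|j _]; last exact: sqr_ge0.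
  (* If [g v = 0] then [M^T v <= 0] while [v >= 0], so [M^T] reverses [v] and [v = 0], although its
     entries add up to 1. *)
  apply/eqP => gv0; suff v00 : v = 0.
    by move: v1; rewrite v00 big1 => [/eqP|i _]; rewrite ?mxE // eq_sym oner_eq0.
  apply: (sign_nonreversing_tr nrM) => j; rewrite mulr_ge0_le0 //.
  rewrite mxE (eq_bigr (fun i => M i j * v i ord0)) => [|i _]; last by rewrite mxE.
  have /psumr_eq0P := gv0 => /(_ (fun i _ => sqr_ge0 _) j isT) /eqP.
  by rewrite sqrf_eq0 => /eqP yj; rewrite -/(y v j) -yj le_max lexx.
have Mp i : g v <= (M *m p) i ord0.
  (* [h] is [M^T (e_i - v)], and [S] is half the derivative of [g] at [v] towards the vertex [e_i]
     of the simplex. *)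
  pose h j := M i j - y v j.
  pose S := \sum_j p j ord0 * h j; pose H := \sum_j h j ^+ 2.
  have SE : S = (M *m p) i ord0 - g v.
    rewrite mxE gv -sumrB; apply: eq_bigr => j _; rewrite pE /h.
    by have [y0|y0] := leP (y v j) 0; rewrite ?mul0r; ring.
  have H0 : 0 <= H by apply: sumr_ge0 => j _; exact: sqr_ge0.
  (* Since [max (y + t h) 0] is at most [|p + t h|], the increment [g w - g v] is at most
     [2 t S + t^2 H]. *)
  have ineq t : 0 < t -> t <= 1 -> 0 <= S *+ 2 + t * H.
    move=> t0 t1; pose w := v + t *: (delta_mx i ord0 - v).
    have wE k : w k ord0 = (1 - t) * v k ord0 + t * (k == i)%:R.
      by rewrite !mxE eqxx andbT; ring.
    have Kw : g v <= g w.
      apply: vmin; split=> [k|].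
        by rewrite wE addr_ge0 ?mulr_ge0 ?subr_ge0 ?ler0n // ltW.
      rewrite (eq_bigr _ (fun k _ => wE k)) big_split /= -!mulr_sumr v1.
      rewrite (bigD1 i) //= eqxx big1 => [|k /negPf -> //].
      by rewrite addr0 !mulr1 subrK.
    have yw j : y w j = y v j + t * h j.
      rewrite /y (eq_bigr (fun k => (1 - t) * (M k j * v k ord0) + t * (M k j * (k == i)%:R))); last first.
        by move=> k _; rewrite wE; ring.
      rewrite big_split /= -!mulr_sumr -/(y v j) [X in _ + t * X = _](bigD1 i) //= eqxx.
      by rewrite big1 => [|k /negPf ->]; rewrite /h ?mulr0 // mulr1 addr0; ring.
    rewrite -(pmulr_rge0 _ t0) mulrDr mulrA -expr2.
    have -> : t * (S *+ 2) + t ^+ 2 * H = \sum_j ((p j ord0 + t * h j) ^+ 2 - p j ord0 ^+ 2).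
      rewrite /S /H -sumrMnl !mulr_sumr -big_split /=; apply: eq_bigr => j _.
      by ring.
    rewrite sumrB -gv subr_ge0 (le_trans Kw) //; apply: ler_sum => j _.
    rewrite yw; have yp : y v j <= p j ord0 by rewrite pE le_max lexx.
    have [yt|yt] := leP (y v j + t * h j) 0; first by rewrite expr0n sqr_ge0.
    by rewrite ler_sqr ?nnegrE ?(ltW yt) ?lerD2r // (le_trans (ltW yt)) // lerD2r.
  rewrite -subr_ge0 -SE leNgt; apply/negP => S0.
  have den : 0 < H - S + 1 by lra.
  (* If [S < 0], this [t] lies in []0, 1]] and makes [2 S + t H] negative. *)
  have := ineq (- S / (H - S + 1)); rewrite divr_gt0 ?oppr_gt0 // ler_pdivrMr // mul1r.
  move=> /(_ isT); have -> : - S <= H - S + 1 by lra.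
  move=> /(_ isT); rewrite mulrAC -[S *+ 2](mulfK (lt0r_neq0 den)) -mulrDl.
  rewrite pmulr_lge0 ?invr_gt0 //; nra.
(* Entries of [p] may vanish. Adding a small multiple [d] of the all-ones vector makes them positive
   and, with [c = M 1], keeps the entries of [M p + d c] at least [d]. *)
pose c i := (M *m (const_mx 1 : 'cV[R]_n.+1)) i ord0.
have [d d0 dle] : exists2 d, 0 < d & forall i, d <= (M *m p) i ord0 / (1 + `|c i|).
  by apply: finite_lower_bound => i; apply: divr_gt0; [exact: lt_le_trans g0 (Mp i) | rewrite ltr_wpDr].
exists (p + d *: const_mx 1) => i; first by rewrite mxE [X in _ + X]mxE [const_mx _ _ _]mxE mulr1 ltr_wpDl.
rewrite mulmxDr -scalemxAr mxE [X in _ + X]mxE -/(c i).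
have dc : d * (1 + `|c i|) <= (M *m p) i ord0.
  by rewrite -ler_pdivlMr; [exact: dle | rewrite ltr_wpDr].
have : - `|c i| <= c i by rewrite lerNl ler_normr lexx orbT.
by move=> ci; nra.
Qed.

(** * The Gale-Nikaido theorem *)

Section Between.
Variable R : realDomainType.
Implicit Types a b x : R.

(** Orientation by [sg (b - a)] treats [a < b] and [b < a] alike. In the converse [between_sg], the
    case [a = b] has sign 0 and rests on the last hypothesis. *)
Lemma sg_between a b x : Num.min a b <= x <= Num.max a b ->
  [/\ Num.sg (b - a) * (x - a) = `|x - a|, 0 <= Num.sg (b - a) * (b - x)
    & a = b -> x = a].
Proof.
have [ab|ab|->] := ltgtP a b => /andP[ax xb].
- have -> : Num.sg (b - a) = 1 by rewrite gtr0_sg ?subr_gt0.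
  rewrite !mul1r ger0_norm ?subr_ge0 //; split=> // eab.
  by rewrite eab ltxx in ab.
- have -> : Num.sg (b - a) = -1 by rewrite ltr0_sg ?subr_lt0.
  rewrite !mulN1r ler0_norm ?subr_le0 // oppr_ge0 subr_le0; split=> // eab.
  by rewrite eab ltxx in ab.
- have -> : x = b by apply/le_anti/andP.
  by rewrite !subrr sgr0 mul0r normr0; split.
Qed.

Lemma between_sg a b x :
  0 <= Num.sg (b - a) * (x - a) -> 0 <= Num.sg (b - a) * (b - x) ->
  (a = b -> x = a) -> Num.min a b <= x <= Num.max a b.
Proof.
have [ab|ab|->] := ltgtP a b.
- have -> : Num.sg (b - a) = 1 by rewrite gtr0_sg ?subr_gt0.
  by rewrite !mul1r !subr_ge0 => -> -> _.
- have -> : Num.sg (b - a) = -1 by rewrite ltr0_sg ?subr_lt0.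
  by rewrite !mulN1r !oppr_ge0 !subr_le0 => -> -> _.
- by move=> _ _ ->; rewrite ?lexx.
Qed.

End Between.

(** * First-order behaviour at a point *)

Section LocalBehaviour.
Variables (R : realType) (n : nat) (X : set 'cV[R]_n) (f : 'cV[R]_n -> 'cV[R]_n).
Implicit Types (x a c : 'cV[R]_n) (J : 'M[R]_n) (s : 'rV[R]_n).

Lemma jacobian_continuous x J : has_jacobian_within X f x J ->
  forall e, 0 < e -> exists2 d, 0 < d &
    forall y, X y -> `|y - x| < d -> `|f y - f x| < e.
Proof.
move=> fJ e e0; have [C C0 JC] := mulmx_norm_le J.
have [d d0 fd] := jacobian_dist fJ ltr01.
exists (Num.min d (e / (1 + C))); first by rewrite lt_min d0 divr_gt0 ?addr_gt0.
move=> y Xy; rewrite lt_min => /andP[yd ye].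
have -> : f y - f x = (f y - f x - J *m (y - x)) + J *m (y - x) by rewrite subrK.
apply: le_lt_trans (ler_normD _ _) _.
apply: (@le_lt_trans _ _ ((1 + C) * `|y - x|)).
  by rewrite mulrDl lerD ?fd.
by rewrite mulrC -ltr_pdivlMr ?addr_gt0.
Qed.

(* With p > 0 and M^T p > 0 for the conjugate M of J by s, the pairing of p
   with s (f x - f a) is at least a multiple of |x - a|. *)
Lemma jacobian_isolated a J s :
  has_jacobian_within X f a J -> sign_nonreversing J ->
  (forall i, s 0 i \in [:: 0; 1; -1]) ->
  exists2 r, 0 < r & forall x, X x -> `|x - a| < r ->
    (forall i, s 0 i * (x i ord0 - a i ord0) = `|x i ord0 - a i ord0|) ->
    (forall i, s 0 i * (f x i ord0 - f a i ord0) <= 0) -> x = a.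
Proof.
move=> fJ nrJ s01.
have [p p0 q0] := sign_nonreversing_pos (sign_nonreversing_tr (sign_nonreversing_conj nrJ s01)).
set M := _ + _ in q0; set q := M^T *m p in q0.
have [mu mu0 muq] := finite_lower_bound q0.
pose P := \sum_i p i ord0.
have P0 : 0 <= P by apply: sumr_ge0 => i _; exact: ltW.
(* Chosen so that [e * P < mu]: the first-order error cannot offset the gain [mu |u|]. *)
pose e := mu / (P + 1) / 2.
have e0 : 0 < e by rewrite !divr_gt0 // ltr_wpDl.
have eP : e * P < mu.
  rewrite /e -mulrA mulrC mulrA ltr_pdivrMr ?ltr_wpDl // mulrC; nra.
have [r r0 fr] := jacobian_dist fJ e0; exists r => // x Xx xr xs fs.
pose u := x - a; pose w := diag_mx s *m u.
have uE i : u i ord0 = x i ord0 - a i ord0 by rewrite !mxE.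
have wE i : w i ord0 = `|u i ord0| by rewrite diag_mulmxE uE xs.
(* Where [s i = 0], the sign condition on [x] forces [u i = 0]. *)
have s2u i : s 0 i ^+ 2 * u i ord0 = u i ord0.
  have := s01 i; rewrite !inE => /or3P[] /eqP si; rewrite si ?sqrrN ?expr1n ?mul1r //.
  by apply/eqP; rewrite expr0n mul0r eq_sym -normr_eq0 -wE diag_mulmxE si mul0r.
have swu : diag_mx s *m w = u.
  by apply/colP => i; rewrite !diag_mulmxE mulrA -expr2 s2u.
have Mw i : (M *m w) i ord0 = s 0 i * (J *m u) i ord0.
  rewrite mulmxDl -!mulmxA swu mxE !diag_mulmxE [X in _ + X * _]mxE.
  by rewrite mulrBl mul1r mulrA -exprSr exprS -mulrA s2u subrr addr0.
have lower : mu * `|u| <= \sum_i p i ord0 * (s 0 i * (J *m u) i ord0).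
  have -> : \sum_i p i ord0 * (s 0 i * (J *m u) i ord0) = \sum_j q j ord0 * `|u j ord0|.
    under eq_bigr => i _ do rewrite -Mw mxE mulr_sumr.
    rewrite exchange_big /=; apply: eq_bigr => j _; rewrite -wE /q [(M^T *m p) _ _]mxE mulr_suml.
    by apply: eq_bigr => i _; rewrite [M^T _ _]mxE mulrA [p i ord0 * _]mulrC.
  apply: (@le_trans _ _ (\sum_j mu * `|u j ord0|)).
    rewrite -mulr_sumr ler_wpM2l ?(ltW mu0) //; apply: cV_norm_le => [|i].
      exact: sumr_ge0.
    by rewrite (bigD1 i) //= lerDl sumr_ge0.
  by apply: ler_sum => j _; rewrite ler_wpM2r ?muq.
(* As [s (f x - f a) <= 0] in each coordinate, [s (J u)] is bounded there by the error [e |u|]. *)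
have upper : \sum_i p i ord0 * (s 0 i * (J *m u) i ord0) <= e * P * `|u|.
  rewrite mulrAC mulr_sumr; apply: ler_sum => i _; rewrite mulrC; apply: ler_wpM2r; first exact: ltW.
  have rho : `|(f x - f a - J *m u) i ord0| <= e * `|u|.
    by apply: le_trans (cV_coord_le _ _) _; exact: fr.
  have fJu : (f x - f a - J *m u) i ord0 = f x i ord0 - f a i ord0 - (J *m u) i ord0.
    by rewrite mxE [X in X + _]mxE [X in _ + X + _]mxE [X in _ + X]mxE.
  rewrite fJu ler_norml in rho; case/andP: rho => rho1 rho2.
  have := fs i; have := s01 i; rewrite !inE => /or3P[] /eqP ->; last 2 first.
  - by rewrite !mul1r => ?; lra.
  - by rewrite !mulN1r => ?; lra.
  - by rewrite !mul0r mulr_ge0 // ltW.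
have : `|u| <= 0.
  have := normr_ge0 u; rewrite le_eqVlt => /predU1P[<- //|u0].
  by have := le_trans lower upper; rewrite ler_pM2r // leNgt eP.
by rewrite normr_le0 subr_eq0 => /eqP.
Qed.

(** Take [p > 0] with [M p > 0] for the conjugate [M] of [J] by [s]. Where [s] is nonzero, the step
    [- t s p] lowers [s f] by at least [t mu] to first order, and [e] is chosen so that the error is
    at most [t mu]. *)
Lemma jacobian_descent c J s :
  has_jacobian_within X f c J -> sign_nonreversing J ->
  (forall i, s 0 i \in [:: 0; 1; -1]) ->
  exists p : 'cV[R]_n, (forall i, 0 < p i ord0) /\
    exists2 r, 0 < r & forall t, 0 < t -> t < r ->
      let x := c - t *: (diag_mx s *m p) in X x ->
      forall i, s 0 i * (f x i ord0 - f c i ord0) <= 0.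
Proof.
move=> fJ nrJ s01.
have [p p0 Mp0] := sign_nonreversing_pos (sign_nonreversing_conj nrJ s01).
exists p; split=> //; set M := _ + _ in Mp0.
have [mu mu0 muM] := finite_lower_bound Mp0.
pose v := diag_mx s *m p; pose e := mu / (1 + `|v|).
have v1 : 0 < 1 + `|v| by rewrite ltr_wpDr.
have e0 : 0 < e by rewrite divr_gt0.
have [d d0 fd] := jacobian_dist fJ e0.
exists (d / (1 + `|v|)); first by rewrite divr_gt0.
move=> t t0 tr x Xx i; have xc : x - c = - (t *: v) by rewrite /x addrAC subrr add0r.
have nxc : `|x - c| = t * `|v| by rewrite xc normrN normrZ gtr0_norm.
have tv : `|x - c| < d.
  rewrite nxc; rewrite ltr_pdivlMr // in tr; apply: le_lt_trans tr.
  by rewrite ler_pM2l // lerDr.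
have rho : `|(f x - f c - J *m (x - c)) i ord0| <= t * mu.
  apply: le_trans (cV_coord_le _ _) _; apply: le_trans (fd x Xx tv) _.
  rewrite nxc mulrCA ler_pM2l // /e mulrAC ler_pdivrMr // ler_pM2l //.
  by rewrite lerDr.
have fJu : (f x - f c - J *m (x - c)) i ord0 = f x i ord0 - f c i ord0 + t * (J *m v) i ord0.
  rewrite xc mulmxN -scalemxAr opprK mxE [X in X + _]mxE [X in _ + X + _]mxE.
  by rewrite [X in _ + X]mxE.
rewrite fJu ler_norml in rho; case/andP: rho => rho1 rho2.
have := muM i; rewrite /M mulmxDl -!mulmxA -/v mxE !diag_mulmxE [X in _ + X * _]mxE.
have := s01 i; rewrite !inE => /or3P[] /eqP ->; first by rewrite !mul0r.
- by rewrite expr1n subrr mul0r addr0 !mul1r => Jv; nra.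
- by rewrite sqrrN expr1n subrr mul0r addr0 !mulN1r => Jv; nra.
Qed.

End LocalBehaviour.

Lemma rectangular_between (R : realType) (n : nat) (X : set 'cV[R]_n)
    (a b x : 'cV[R]_n) :
  rectangular X -> X a -> X b ->
  (forall i, Num.min (a i ord0) (b i ord0) <= x i ord0 <= Num.max (a i ord0) (b i ord0)) ->
  X x.
Proof.
case=> I -> /= Xa Xb xab i; have := xab i.
have [_|_] := leP (a i ord0) (b i ord0) => xi.
- exact: (interval_is_interval (Xa i) (Xb i) xi).
- exact: (interval_is_interval (Xb i) (Xa i) xi).
Qed.

Lemma affine_coord_continuous (R : realType) (n : nat) (i : 'I_n) (s a : R) :
  continuous (fun x : 'cV[R]_n => s * (x i ord0 - a)).
Proof.
move=> x; have cs : {for x, continuous (fun x : 'cV[R]_n => s)} by exact: cst_continuous.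
have cx : {for x, continuous (fun x : 'cV[R]_n => x i ord0 - a)}.
  by apply: continuousB; [exact: coord_continuous | exact: cst_continuous].
exact (continuousM cs cx).
Qed.

(** Each [h i] is continuous on [K] only, so its sublevel set is closed relative to [K];
    intersecting with the closed set [K] makes it closed. *)
Lemma closed_within_le (R : realType) (n : nat) (I : Type) (K : set 'cV[R]_n)
    (h : I -> 'cV[R]_n -> R) :
  closed K -> (forall i, {within K, continuous (h i)}) ->
  closed [set x | K x /\ forall i, h i x <= 0].
Proof.
move=> Kc hc.
have -> : [set x | K x /\ forall i, h i x <= 0] =
    K `&` \bigcap_(i in [set: I]) (K `&` h i @^-1` [set y | y <= 0]).
  rewrite eqEsubset; split=> x; first by move=> [Kx hx]; split=> // i _; split=> //; exact: hx.
  by move=> [Kx hx]; split=> // i; have [] := hx i Logic.I.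
apply: closedI => //; apply: closed_bigI => i _.
have /continuous_closedP/(_ _ (@closed_le _ 0)) := hc i.
move=> /closed_subspaceP[V Vc VK]; rewrite setIC -VK; exact: closedI.
Qed.

(** * P-functions on rectangles *)

Section PFunction.
Variables (R : realType) (n : nat) (X : set 'cV[R]_n).
Variables (F : 'cV[R]_n -> 'cV[R]_n) (DF : 'cV[R]_n -> 'M[R]_n).
Hypothesis X_rect : rectangular X.
Hypothesis F_diff : forall x, X x -> has_jacobian_within X F x (DF x).
Hypothesis DF_nr : forall x, X x -> sign_nonreversing (DF x).

(* Gale and Nikaido's argument, by induction on the number of coordinates in
   which a and b differ. In the box spanned by a and b, take a point c other
   than a that reverses no sign of s = sg (b - a) relative to a and is closest
   to a. If c agrees with a in a new coordinate, induction applies to a and c;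
   otherwise c can be moved towards a along [jacobian_descent]. *)
Lemma P_function a b : X a -> X b ->
  (forall i, (b i ord0 - a i ord0) * (F b i ord0 - F a i ord0) <= 0) -> a = b.
Proof.
have [k] := ubnP #|[set i | a i ord0 != b i ord0]%SET|.
elim: k => // k IH in b *; rewrite ltnS => cardab Xa Xb rev.
apply: contrapT => /eqP ab.
pose s : 'rV[R]_n := \row_i Num.sg (b i ord0 - a i ord0).
have sE i : s 0 i = Num.sg (b i ord0 - a i ord0) by rewrite mxE.
have s01 i : s 0 i \in [:: 0; 1; -1].
  by rewrite sE !inE; case: sgrP => _; rewrite eqxx ?orbT.
have s1 i : `|s 0 i| <= 1.
  by have := s01 i; rewrite !inE => /or3P[] /eqP ->; rewrite ?normrN ?normr1 ?normr0.
pose K := [set x : 'cV[R]_n | forall i,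
  Num.min (a i ord0) (b i ord0) <= x i ord0 <= Num.max (a i ord0) (b i ord0)].
have Ka : K a by move=> i; rewrite ge_min le_max !lexx.
have Kb : K b by move=> i; rewrite ge_min le_max !lexx !orbT.
have KX x : K x -> X x by exact: rectangular_between X_rect Xa Xb.
(* On [K] this is the l1 distance to [a]. *)
pose L (x : 'cV[R]_n) := \sum_i s 0 i * (x i ord0 - a i ord0).
have Ks x i : K x -> s 0 i * (x i ord0 - a i ord0) = `|x i ord0 - a i ord0|.
  by move=> /(_ i) /sg_between[+ _ _]; rewrite sE.
have KL x : K x -> `|x - a| <= L x.
  move=> Kx; have L0 i : 0 <= s 0 i * (x i ord0 - a i ord0) by rewrite Ks.
  apply: cV_norm_le => [|i]; first by apply: sumr_ge0.
  rewrite [(x - a) _ _]mxE [(- a) _ _]mxE -Ks // /L (bigD1 i) //= lerDl.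
  by apply: sumr_ge0.
(* Isolation of [a] replaces the condition [x != a], which is not closed, by the closed condition
   [r <= L x], the [None] case of [h]. *)
have [r r0 riso] := jacobian_isolated (F_diff Xa) (DF_nr Xa) s01.
have Lr x : K x -> (forall i, s 0 i * (F x i ord0 - F a i ord0) <= 0) -> x != a -> r <= L x.
  move=> Kx Fx xa; apply: le_trans (KL x Kx); rewrite leNgt; apply: contra xa => xr.
  by apply/eqP; apply: riso => // [|i]; [exact: KX | exact: Ks].
pose h (i : option 'I_n) (x : 'cV[R]_n) : R :=
  if i is Some i then s 0 i * (F x i ord0 - F a i ord0) else r - L x.
have Kcl : closed K.
  have -> : K = \bigcap_(i in [set: 'I_n]) ((fun x : 'cV[R]_n => x i ord0) @^-1`
      `[Num.min (a i ord0) (b i ord0), Num.max (a i ord0) (b i ord0)]%classic).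
    rewrite eqEsubset; split=> [x Kx i _|x Kx i].
      by rewrite /= in_itv /=; exact: Kx.
    by have := Kx i Logic.I; rewrite /= in_itv.
  apply: closed_bigI => i _; apply: preimage_closed (@itv_closed _ _ _ _) => x _.
  exact: coord_continuous.
have Lc : continuous L.
  by apply: sum_continuous => i; exact: affine_coord_continuous.
have hc i : {within K, continuous (h i)}.
  case: i => [i|] /=.
    apply: within_continuous_of_dist => x Kx e e0.
    have [d d0 dF] := jacobian_continuous (F_diff (KX x Kx)) e0.
    exists d => // y Ky yx; have /= -> : s 0 i * (F y i ord0 - F a i ord0) -
      s 0 i * (F x i ord0 - F a i ord0) = s 0 i * (F y - F x) i ord0.
      by rewrite [(F y - F x) _ _]mxE [(- F x) _ _]mxE; ring.
    rewrite normrM; apply: le_lt_trans (dF y (KX y Ky) yx).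
    apply: le_trans (cV_coord_le _ i); rewrite -[leRHS]mul1r.
    by rewrite ler_wpM2r.
  apply: continuous_subspaceT => x.
  by apply: continuousB; [exact: cst_continuous | exact: Lc].
pose Y := [set x | K x /\ forall i, h i x <= 0].
have YP x : K x -> (forall i, s 0 i * (F x i ord0 - F a i ord0) <= 0) -> x != a -> Y x.
  by move=> Kx Fx xa; split=> // -[i|] /=; [exact: Fx | rewrite subr_le0 Lr].
have Yb : Y b.
  apply: YP => //; last by rewrite eq_sym.
  move=> i; rewrite sE; have := rev i.
  have [d0|d0|->] := ltgtP (b i ord0 - a i ord0) 0; last by rewrite sgr0 !mul0r.
  - by rewrite (ltr0_sg d0) mulN1r oppr_le0 nmulr_rle0.
  - by rewrite (gtr0_sg d0) mul1r pmulr_rle0.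
have [c [Kc hcle] cmin] : exists2 c, Y c & forall x, Y x -> L c <= L x.
  apply: cV_argmin; first by exists b.
  - exists (`|a| + `|b - a|); split; first exact: num_real.
    move=> M MM x [Kx _]; apply: le_trans (ltW MM).
    have -> : x = a + (x - a) by rewrite addrCA subrr addr0.
    apply: le_trans (ler_normD _ _) _; rewrite lerD2l.
    apply: cV_norm_le => // i; apply: le_trans (cV_coord_le _ i).
    rewrite [(x - a) _ _]mxE [(b - a) _ _]mxE [(- a) _ _]mxE -(Ks x) // -(Ks b) //.
    have [_ + _] := sg_between (Kx i); rewrite -sE => bx.
    by rewrite -subr_ge0 -mulrBr opprB addrA subrK.
  - exact: closed_within_le.
  - exact: continuous_subspaceT.
have Fc i : s 0 i * (F c i ord0 - F a i ord0) <= 0 by exact: (hcle (Some i)).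
have rLc : r <= L c by have := hcle None; rewrite /= subr_le0.
have ac : a != c.
  apply/eqP => ac; move: rLc; rewrite -ac /L big1 ?leNgt ?r0 // => i _.
  by rewrite subrr mulr0.
have eqab i : a i ord0 = b i ord0 -> c i ord0 = a i ord0.
  by move=> abi; have [_ _] := sg_between (Kc i); apply.
(* If [c] meets [a] in a new coordinate, induction gives [a = c], a contradiction. *)
have [/existsP[i /andP[abi /eqP ci]]|/existsPn nolow] :=
    boolP [exists i, (a i ord0 != b i ord0) && (c i ord0 == a i ord0)].
  case/eqP: ac; apply: IH => //; last 2 first.
  - exact: KX.
  - move=> j; have := Fc j; have := Ks c j Kc; rewrite !sE.
    have [d0|d0|d0] := ltgtP (b j ord0 - a j ord0) 0.
    + by rewrite (ltr0_sg d0) !mulN1r => Kj Fj; rewrite -mulrNN Kj mulr_ge0_le0.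
    + by rewrite (gtr0_sg d0) !mul1r => Kj Fj; rewrite Kj mulr_ge0_le0.
    + have /eqP := d0; rewrite subr_eq0 eq_sym => /eqP/eqab ->.
      by rewrite subrr mul0r.
  apply: leq_trans cardab; apply: proper_card; apply/properP; split.
    apply/fintype.subsetP => j; rewrite !inE; apply: contra => /eqP abj.
    by rewrite (eqab j abj).
  by exists i; rewrite !inE // ci eqxx.
have low i : a i ord0 != b i ord0 -> 0 < s 0 i * (c i ord0 - a i ord0).
  move=> abi; rewrite Ks // normr_gt0 subr_eq0.
  by have := nolow i; rewrite abi.
have Xc := KX c Kc.
have [p [p0 [d d0 pd]]] := jacobian_descent (F_diff Xc) (DF_nr Xc) s01.
(* A step below these bounds keeps each coordinate strictly on the [b] side of [a]; 1 is a filler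
   where [a] and [b] agree. *)
pose m i := if a i ord0 == b i ord0 then 1 else s 0 i * (c i ord0 - a i ord0) / p i ord0.
have [e e0 em] : exists2 e, 0 < e & forall i, e <= m i.
  apply: finite_lower_bound => i; rewrite /m; case: ifPn => // abi.
  by rewrite divr_gt0 ?low.
pose t := Num.min d e / 2.
have de0 : 0 < Num.min d e by rewrite lt_min d0 e0.
have t0 : 0 < t by rewrite divr_gt0.
have tmin : t < Num.min d e by rewrite ltr_pdivrMr // ltr_pMr // ltr1n.
have [td te] : t < d /\ t < e by move: tmin; rewrite lt_min => /andP.
pose x := c - t *: (diag_mx s *m p).
have xE i : x i ord0 = c i ord0 - t * (s 0 i * p i ord0).
  by rewrite mxE [X in _ + X]mxE [X in - X]mxE diag_mulmxE.
have s2 i : a i ord0 != b i ord0 -> s 0 i ^+ 2 = 1.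
  by move=> abi; rewrite sE sqr_sg subr_eq0 eq_sym abi.
have sx i y : a i ord0 != b i ord0 ->
    s 0 i * (x i ord0 - y) = s 0 i * (c i ord0 - y) - t * p i ord0.
  move=> abi; rewrite xE -[X in _ = _ - X]mul1r -(s2 i abi); ring.
have xlow i : a i ord0 != b i ord0 -> 0 < s 0 i * (x i ord0 - a i ord0).
  move=> abi; rewrite sx // subr_gt0 -ltr_pdivlMr //; apply: lt_le_trans te _.
  by have := em i; rewrite /m (negPf abi).
have Kx : K x.
  move=> i; have [abi|abi] := eqVneq (a i ord0) (b i ord0).
    have -> : x i ord0 = c i ord0; last exact: Kc.
    by rewrite xE sE abi subrr sgr0 mul0r mulr0 subr0.
  apply: between_sg; rewrite -?sE ?(ltW (xlow i abi)) //; last by move/eqP: abi.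
  rewrite -opprB mulrN sx // opprB; apply: addr_ge0.
    by apply: mulr_ge0; exact: ltW.
  by have [_ + _] := sg_between (Kc i); rewrite -sE -mulrN opprB.
have Fx i : s 0 i * (F x i ord0 - F a i ord0) <= 0.
  have := pd t t0 td (KX x Kx) i; have := Fc i; lra.
have [i abi] : exists i, a i ord0 != b i ord0.
  apply/existsP; apply: contraNT ab => /existsPn abE.
  by apply/eqP/colP => i; apply/eqP; have := abE i; rewrite negbK.
have xa : x != a.
  by apply/eqP => xa; have := xlow i abi; rewrite xa subrr mulr0 ltxx.
(* [x] is admissible and strictly closer to [a] than [c], against minimality. *)
have := cmin x (YP x Kx Fx xa); rewrite leNgt => /negP; apply.
rewrite /L (bigD1 i) //= [ltRHS](bigD1 i) //=; apply: ltr_leD.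
  by rewrite sx // ltrBlDr ltrDl mulr_gt0.
apply: ler_sum => j _; have [abj|abj] := eqVneq (a j ord0) (b j ord0).
  by rewrite sE abj subrr sgr0 !mul0r.
by rewrite sx // lerBlDr lerDl mulr_ge0 // ltW.
Qed.

End PFunction.

(** * Injectivity *)

Section Jacobians.
Variables (R : realType) (n : nat) (X : set 'cV[R]_n).
Implicit Types (f g : 'cV[R]_n -> 'cV[R]_n) (x : 'cV[R]_n) (J : 'M[R]_n).

Lemma jacobianB f g x Jf Jg :
  has_jacobian_within X f x Jf -> has_jacobian_within X g x Jg ->
  has_jacobian_within X (fun y => f y - g y) x (Jf - Jg).
Proof.
move=> fJ gJ; apply: jacobian_of_dist => e e0.
have e20 : 0 < e / 2 by rewrite divr_gt0.
have [d d0 fd] := jacobian_dist fJ e20; have [d' d'0 gd] := jacobian_dist gJ e20.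
exists (Num.min d d'); first by rewrite lt_min d0 d'0.
move=> y Xy; rewrite lt_min => /andP[yd yd'].
have -> : f y - g y - (f x - g x) - (Jf - Jg) *m (y - x) =
    (f y - f x - Jf *m (y - x)) - (g y - g x - Jg *m (y - x)).
  by rewrite mulmxBl; apply/matrixP => i j; rewrite !mxE; ring.
apply: le_trans (ler_normB _ _) _.
have -> : e * `|y - x| = e / 2 * `|y - x| + e / 2 * `|y - x| by rewrite -mulrDl -splitr.
by apply: lerD; [exact: fd | exact: gd].
Qed.

Lemma jacobian_linear (M : 'M[R]_n) x : has_jacobian_within X (mulmx M) x M.
Proof.
apply: jacobian_of_dist => e e0; exists 1 => // y _ _.
by rewrite mulmxBr subrr normr0 mulr_ge0 // ltW.
Qed.

(** Fix [i] and let [z] take coordinate [i] from [y] and the others from [x]. It lies in the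
    rectangle, [f z] and [f y] agree in coordinate [i], and only [J i i] contributes to that
    coordinate of [J (z - x)]. *)
Lemma jacobian_diagonal (phi : 'I_n -> R -> R) f x J :
  rectangular X -> (forall y, X y -> forall i, f y i ord0 = phi i (y i ord0)) ->
  X x -> has_jacobian_within X f x J ->
  has_jacobian_within X f x (diag_mx (\row_i J i i)).
Proof.
move=> Xr fphi Xx fJ; apply: jacobian_of_dist => e e0.
have [d d0 fd] := jacobian_dist fJ e0; exists d => // y Xy yd.
apply: cV_norm_le => [|i]; first by rewrite mulr_ge0 // ltW.
pose z : 'cV[R]_n := \col_j (if j == i then y j ord0 else x j ord0).
have zE j : z j ord0 = if j == i then y j ord0 else x j ord0 by rewrite mxE.
have Xz : X z.
  apply: (rectangular_between Xr Xx Xy) => j; rewrite zE.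
  by case: ifP => _; rewrite ge_min le_max !lexx ?orbT.
have zx j : (z - x) j ord0 = (y i ord0 - x i ord0) *+ (j == i).
  rewrite [LHS]mxE zE mxE; have [->|] := eqVneq; first by rewrite mulr1n.
  by rewrite subrr mulr0n.
have nzx : `|z - x| <= `|y - x|.
  apply: cV_norm_le => // j; rewrite zx; case: eqP => _; last by rewrite mulr0n normr0.
  by rewrite mulr1n; have := cV_coord_le (y - x) i; rewrite !mxE.
apply: le_trans (_ : `|f z - f x - J *m (z - x)| <= _); last first.
  by apply: le_trans (fd z Xz (le_lt_trans nzx yd)) _; rewrite ler_wpM2l // ltW.
apply: le_trans (cV_coord_le _ i).
have fzi : f z i ord0 = f y i ord0 by rewrite !fphi // zE eqxx.
suff -> : (f z - f x - J *m (z - x)) i ord0 =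
    (f y - f x - diag_mx (\row_i J i i) *m (y - x)) i ord0 by [].
rewrite [LHS]mxE [RHS]mxE [X in X + _ = _]mxE [X in _ = X + _]mxE fzi; congr (_ + _).
rewrite [LHS]mxE [RHS]mxE diag_mulmxE [(\row__ _) _ _]mxE [X in - X = _]mxE.
rewrite (bigD1 i) //= zx eqxx mulr1n big1 => [|j /negPf ji]; last by rewrite zx ji mulr0n mulr0.
by rewrite addr0 [(y - x) _ _]mxE [(- x) _ _]mxE.
Qed.

(* A minimiser of |h - c| over the ball is interior, and there a Newton step
   would decrease |h - c| if it were not 0. *)
Lemma interior_solution (h : 'cV[R]_n -> 'cV[R]_n) (Dh : 'cV[R]_n -> 'M[R]_n)
    (a c : 'cV[R]_n) (rho : R) :
  0 < rho -> (forall x, `|x - a| <= rho -> X x) ->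
  (forall x, X x -> has_jacobian_within X h x (Dh x)) ->
  (forall x, X x -> Dh x \in unitmx) ->
  (forall x, `|x - a| = rho -> `|h a - c| < `|h x - c|) ->
  exists2 x, `|x - a| < rho & h x = c.
Proof.
move=> rho0 KX hJ Ju bd; pose K := [set x : 'cV[R]_n | `|x - a| <= rho].
have Ka : K a by rewrite /K /= subrr normr0 ltW.
have [z Kz zmin] : exists2 z, K z & forall x, K x -> `|h z - c| <= `|h x - c|.
  apply: cV_argmin; first by exists a.
  - exists (`|a| + rho); split; first exact: num_real.
    move=> M MM x Kx; apply: le_trans (ltW MM).
    have -> : x = a + (x - a) by rewrite addrCA subrr addr0.
    by apply: le_trans (ler_normD _ _) _; rewrite lerD2l.
  - apply: closed_of_dist => x /negP; rewrite -ltNge => xa.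
    exists (`|x - a| - rho); first by rewrite subr_gt0.
    move=> y yx; apply/negP; rewrite -ltNge.
    have := ler_distD y x a; rewrite (distrC x y); lra.
  - apply: within_continuous_of_dist => x Kx e e0.
    have [d d0 hd] := jacobian_continuous (hJ x (KX x Kx)) e0.
    exists d => // y Ky yx; apply: le_lt_trans (hd y (KX y Ky) yx).
    have -> : h y - h x = (h y - c) - (h x - c) by rewrite opprB addrA subrK.
    exact: ler_dist_dist.
have za : `|z - a| < rho.
  rewrite lt_neqAle Kz andbT; apply/eqP => /bd.
  by rewrite ltNge zmin.
exists z => //; apply: contrapT => hz; pose w := h z - c.
have w0 : 0 < `|w| by rewrite normr_gt0 subr_eq0; apply/eqP.
have Xz := KX z Kz; pose v := invmx (Dh z) *m w.
have vw : Dh z *m v = w by rewrite mulKVmx ?Ju.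
have v1 : 0 < 1 + `|v| by rewrite ltr_wpDr.
have e0 : 0 < `|w| / 2 / (1 + `|v|) by rewrite !divr_gt0.
have [d d0 hd] := jacobian_dist (hJ z Xz) e0.
(* The three bounds keep [t] below 1, [x] within reach of the linear approximation at [z], and [x]
   in the ball. *)
pose t0 := Num.min 1 (Num.min (d / (1 + `|v|)) ((rho - `|z - a|) / (1 + `|v|))).
have t00 : 0 < t0 by rewrite !lt_min ltr01 !divr_gt0 ?subr_gt0.
pose t := t0 / 2.
have tp : 0 < t by rewrite divr_gt0.
have : t < t0 by rewrite ltr_pdivrMr // ltr_pMr // ltr1n.
rewrite !lt_min !ltr_pdivlMr // => /and3P[t1 td tr].
have tv : t * `|v| <= t * (1 + `|v|) by rewrite ler_pM2l // lerDr.
pose x := z - t *: v; have xz : x - z = - (t *: v) by rewrite /x addrAC subrr add0r.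
have nxz : `|x - z| = t * `|v| by rewrite xz normrN normrZ gtr0_norm.
have Kx : K x.
  by rewrite /K /=; have := ler_distD z x a; rewrite nxz; lra.
have /hd : X x by exact: KX.
rewrite nxz => /(_ (le_lt_trans tv td)); rewrite xz mulmxN -scalemxAr vw opprK => hx.
have := zmin x Kx; rewrite leNgt => /negP; apply.
(* The first summand is at most [t |w| / 2], so the norm is at most [(1 - t / 2) |w|]. *)
have -> : h x - c = (h x - h z + t *: w) + (1 - t) *: w.
  by rewrite scalerBl scale1r /w; apply/matrixP => i j; rewrite !mxE; ring.
apply: le_lt_trans (ler_normD _ _) _.
rewrite normrZ gtr0_norm ?subr_gt0 // -/w.
have : `|w| / 2 / (1 + `|v|) * (t * `|v|) <= t * (`|w| / 2).
  rewrite mulrCA ler_pM2l // mulrAC ler_pdivrMr // ler_pM2l ?divr_gt0 //.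
  by rewrite lerDr.
have : 0 < t * `|w| by rewrite mulr_gt0.
by move: hx; lra.
Qed.

End Jacobians.

Lemma sign_nonreversing_unitmx (R : realFieldType) (n : nat) (M : 'M[R]_n) :
  sign_nonreversing M -> M \in unitmx.
Proof.
move=> nrM; rewrite unitmxE unitfE; apply/negP => /det0P[v v0 vM].
case/negP: v0; suff /(congr1 trmx) : v^T = 0 by rewrite trmxK trmx0 => ->.
apply: (sign_nonreversing_tr nrM) => i.
by rewrite -trmx_mul vM trmx0 [X in _ * X]mxE mulr0.
Qed.

Lemma unitmx_norm_ge (R : realType) (n : nat) (M : 'M[R]_n) : M \in unitmx ->
  exists2 k, 0 < k & forall u : 'cV[R]_n, k * `|u| <= `|M *m u|.
Proof.
move=> Mu; have [C C0 MC] := mulmx_norm_le (invmx M).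
exists C^-1 => [|u]; first by rewrite invr_gt0.
by rewrite mulrC ler_pdivrMr // mulrC -{1}[u](mulKmx Mu).
Qed.

Section Injectivity.
Variables (R : realType) (n : nat) (X : set 'cV[R]_n).
Variables (f : 'cV[R]_n -> 'cV[R]_n) (Df : 'cV[R]_n -> 'M[R]_n).
Hypothesis X_rect : rectangular X.
Hypothesis f_diff : forall x, X x -> has_jacobian_within X f x (Df x).

(* With d = 0 this is nondegeneracy; with d > 0 it puts no condition on G
   besides the absence of e-cycles. *)
Definition factor_nondegenerate_off (d : 'rV[R]_n) x :=
  exists (m : nat) (G : dsr n m),
    [/\ dsr_factor (Df x) G,
        forall gamma : {set 'I_n}, gamma != finset.set0 ->
          (forall i, i \in gamma -> d 0 i = 0) ->
          exists delta, dsr_weakly_nondegenerate_sub G gamma delta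
      & ~ has_e_cycle G].

Lemma factor_sign_nonreversing (d : 'rV[R]_n) x : (forall i, 0 <= d 0 i) ->
  factor_nondegenerate_off d x -> sign_nonreversing (diag_mx d - Df x).
Proof.
move=> d0 [m [G [[A [B [AB GE]]] nd noe]]]; subst G.
by rewrite addrC -AB; apply: dsr_sign_nonreversing.
Qed.

(** [g - f] has Jacobian [diag d - Df], which reverses no sign, and equal values at [a] and [b] make
    all products in [P_function] zero. *)
Lemma sub_injective (g : 'cV[R]_n -> 'cV[R]_n) (d : 'cV[R]_n -> 'rV[R]_n) :
  (forall x, X x -> has_jacobian_within X g x (diag_mx (d x))) ->
  (forall x, X x -> forall i, 0 <= d x 0 i) ->
  (forall x, X x -> factor_nondegenerate_off (d x) x) ->
  forall a b, X a -> X b -> g a - f a = g b - f b -> a = b.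
Proof.
move=> gJ d0 fac a b Xa Xb gf.
apply: (@P_function _ _ X (fun x => g x - f x) (fun x => diag_mx (d x) - Df x)) => //.
- by move=> x Xx; apply: jacobianB; [exact: gJ | exact: f_diff].
- by move=> x Xx; apply: factor_sign_nonreversing; [exact: d0 | exact: fac].
- by move=> i; rewrite /= gf subrr mulr0.
Qed.

Lemma nondegenerate_injective :
  (forall x, X x -> factor_nondegenerate_off 0 x) -> {in X &, injective f}.
Proof.
move=> fac a b /set_mem Xa /set_mem Xb ab.
(* The zero map as [g], written so that [jacobian_linear] applies. *)
apply: (@sub_injective (mulmx 0) (fun=> 0)) => //; last by rewrite !mul0mx ab.
- by move=> x _; rewrite raddf0; exact: jacobian_linear.
- by move=> x _ i; rewrite mxE.
Qed.

Lemma factor_nondegenerate_off_pos (d : 'rV[R]_n) x :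
  (forall i, 0 < d 0 i) ->
  (exists (m : nat) (G : dsr n m), dsr_factor (Df x) G /\ ~ has_e_cycle G) ->
  factor_nondegenerate_off d x.
Proof.
move=> d0 [m [G [GE noe]]]; exists m, G; split=> // gamma /finset.set0Pn[i ig] /(_ i ig) di.
by have := d0 i; rewrite di ltxx.
Qed.

Hypothesis no_e_cycle : forall x, X x ->
  exists (m : nat) (G : dsr n m), dsr_factor (Df x) G /\ ~ has_e_cycle G.

(** Argued for [q - f]: the diagonal of [Dq] serves as [d], and since it is positive no nonempty
    [gamma] meets the condition in [factor_nondegenerate_off]. *)
Lemma sub_diagonal_increasing_injective (q : 'cV[R]_n -> 'cV[R]_n) :
  diagonal_increasing X q -> {in X &, injective (fun x => f x - q x)}.
Proof.
move=> [[phi qphi] [Dq qJ]] a b /set_mem Xa /set_mem Xb ab.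
have d0 x : X x -> forall i, 0 < (\row_i Dq x i i) 0 i.
  by move=> Xx i; rewrite mxE; have [_] := qJ x Xx.
apply: (@sub_injective q (fun x => \row_i Dq x i i)) => //.
- move=> x Xx; apply: (jacobian_diagonal X_rect qphi Xx).
  by have [] := qJ x Xx.
- by move=> x Xx i; exact/ltW/d0.
- by move=> x Xx; apply: factor_nondegenerate_off_pos; [exact: d0 | exact: no_e_cycle].
- by rewrite -[LHS]opprB ab opprB.
Qed.

Let shift (e : R) (x : 'cV[R]_n) := e%:M *m x - f x.

Let shift_diff e x : X x -> has_jacobian_within X (shift e) x (e%:M - Df x).
Proof. by move=> Xx; apply: jacobianB; [exact: jacobian_linear | exact: f_diff]. Qed.

Let shift_nonreversing e x : 0 < e -> X x -> sign_nonreversing (e%:M - Df x).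
Proof.
move=> e0 Xx; rewrite -diag_const_mx; apply: factor_sign_nonreversing => [i|].
  by rewrite mxE ltW.
by apply: factor_nondegenerate_off_pos; [move=> i; rewrite mxE | exact: no_e_cycle].
Qed.

Let shift_injective e : 0 < e -> forall a b, X a -> X b -> shift e a = shift e b -> a = b.
Proof.
move=> e0; apply: (@sub_injective (mulmx e%:M) (fun=> const_mx e)).
- by move=> x Xx; rewrite diag_const_mx; exact: jacobian_linear.
- by move=> x _ i; rewrite mxE ltW.
- by move=> x Xx; apply: factor_nondegenerate_off_pos; [move=> i; rewrite mxE | exact: no_e_cycle].
Qed.

(** Invertibility of [Df a] gives [|f x - f a| >= k rho / 2] on the sphere of radius [rho] about
    [a]. For small [e], the residual of [shift e x = - f a] there exceeds its value [e |a|] at the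
    centre, and [interior_solution] applies. *)
Let shift_solution a r : open X -> X a -> Df a \in unitmx -> 0 < r ->
  exists2 e0, 0 < e0 & forall e, 0 < e -> e < e0 ->
    exists x, [/\ X x, `|x - a| < r & shift e x = - f a].
Proof.
move=> Xo Xa Ju r0; have [k k0 kJ] := unitmx_norm_ge Ju.
have k2 : 0 < k / 2 by rewrite divr_gt0.
have [d1 d10 fd] := jacobian_dist (f_diff Xa) k2.
have [d2 d20 Xd] : exists2 d, 0 < d & forall x, `|x - a| < d -> X x.
  have aX : \forall x \near a, X x by move: Xo; rewrite openE; exact.
  have /nbhs_normP[d d0 dX] := aX.
  by exists d => // x xa; apply: dX; rewrite /ball_ /= distrC.
pose rho := Num.min r (Num.min d1 d2) / 2.
have m0 : 0 < Num.min r (Num.min d1 d2) by rewrite !lt_min r0 d10 d20.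
have rho0 : 0 < rho by rewrite divr_gt0.
have : rho < Num.min r (Num.min d1 d2) by rewrite ltr_pdivrMr // ltr_pMr // ltr1n.
rewrite !lt_min => /and3P[rr rd1 rd2].
have den : 0 < 2 * `|a| + rho by rewrite ltr_wpDl // mulr_ge0.
(* Being below this bound means [e |a| < k rho / 2 - e (|a| + rho)]. *)
exists (k / 2 * rho / (2 * `|a| + rho)); first by rewrite divr_gt0 // mulr_gt0.
move=> e e0; rewrite ltr_pdivlMr // => ek.
have KX x : `|x - a| <= rho -> X x by move=> xa; apply: Xd; exact: le_lt_trans rd2.
have [x xa hx] : exists2 x, `|x - a| < rho & shift e x = - f a.
  apply: (@interior_solution _ _ X (shift e) (fun x => e%:M - Df x)) => //.
  - by move=> x; exact: shift_diff.
  - by move=> x Xx; apply/sign_nonreversing_unitmx/shift_nonreversing.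
  - move=> x xa; have Xx : X x by apply: KX; rewrite xa.
    have -> : shift e a - - f a = e *: a by rewrite opprK /shift subrK mul_scalar_mx.
    have -> : shift e x - - f a = e *: x - (f x - f a).
      by rewrite opprK /shift mul_scalar_mx opprB addrA [RHS]addrAC addrAC.
    rewrite normrZ gtr0_norm //.
    have fx : k * rho - k / 2 * rho <= `|f x - f a|.
      have := fd x Xx; rewrite xa => /(_ rd1) fx; have := kJ (x - a); rewrite xa => kx.
      have := ler_normB (f x - f a) (f x - f a - Df a *m (x - a)).
      rewrite opprB addrCA subrr addr0; lra.
    have ex : e * `|x| <= e * (`|a| + rho).
      rewrite ler_pM2l // -xa -{1}[x](addrNK a) addrC; exact: ler_normD.
    have := lerB_dist (f x - f a) (e *: x); rewrite distrC normrZ (gtr0_norm e0); lra.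
by exists x; split; [exact/KX/ltW | exact: lt_trans rr | ].
Qed.

(** For small [e], [shift e] would take the value [- f a = - f b] in two disjoint balls, about [a]
    and about [b], against its injectivity. *)
Lemma weakly_nondegenerate_injective :
  open X -> (forall x, X x -> Df x \in unitmx) -> {in X &, injective f}.
Proof.
move=> Xo Ju a b /set_mem Xa /set_mem Xb fab; apply: contrapT => /eqP ab.
have r0 : 0 < `|a - b| / 2 by rewrite divr_gt0 // normr_gt0 subr_eq0.
have [ea ea0 sa] := shift_solution Xo Xa (Ju a Xa) r0.
have [eb eb0 sb] := shift_solution Xo Xb (Ju b Xb) r0.
pose e := Num.min ea eb / 2.
have m0 : 0 < Num.min ea eb by rewrite lt_min ea0 eb0.
have e0 : 0 < e by rewrite divr_gt0.
have : e < Num.min ea eb by rewrite ltr_pdivrMr // ltr_pMr // ltr1n.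
rewrite lt_min => /andP[lea leb].
have [x [Xx xa xE]] := sa e e0 lea; have [y [Xy yb yE]] := sb e e0 leb.
have xy : x = y by apply: (shift_injective e0) => //; rewrite xE yE fab.
have := ler_distD x a b; rewrite (distrC a x) {2}xy; lra.
Qed.

End Injectivity.

Theorem theorem8 (R : realType) (n : nat) (X : set 'cV[R]_n)
    (f : 'cV[R]_n -> 'cV[R]_n) (Df : 'cV[R]_n -> 'M[R]_n)
    (X_rect : rectangular X)
    (f_diff : forall x, X x -> has_jacobian_within X f x (Df x)) :
  ((forall x, X x ->
      exists (m : nat) (G : dsr n m),
        [/\ dsr_factor (Df x) G, dsr_nondegenerate G & ~ has_e_cycle G]) ->
    {in X &, injective f} /\
    (forall q : 'cV[R]_n -> 'cV[R]_n, diagonal_increasing X q ->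
       {in X &, injective (fun x => f x - q x)})) /\
  (open X ->
   (forall x, X x ->
      exists (m : nat) (G : dsr n m),
        [/\ dsr_factor (Df x) G, dsr_weakly_nondegenerate G & ~ has_e_cycle G]) ->
    {in X &, injective f} /\
    (forall q : 'cV[R]_n -> 'cV[R]_n, diagonal_increasing X q ->
       {in X &, injective (fun x => f x - q x)})).
Proof.
split=> [nd|Xo wnd].
  split; last first.
    apply: (sub_diagonal_increasing_injective X_rect f_diff) => x /nd[m [G [GE _ noe]]].
    by exists m, G.
  apply: (nondegenerate_injective X_rect f_diff) => x /nd[m [G [GE Gnd noe]]].
  exists m, G; split=> // gamma /Gnd[delta [_ Gd]] _; by exists delta.
have noe x : X x -> exists (m : nat) (G : dsr n m), dsr_factor (Df x) G /\ ~ has_e_cycle G.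
  by move=> /wnd[m [G [GE _ noe]]]; exists m, G.
split; last exact: (sub_diagonal_increasing_injective X_rect f_diff noe).
apply: (weakly_nondegenerate_injective X_rect f_diff noe Xo) => x.
move=> /wnd[m [G [[A [B [AB GE]]] Gwnd Gnoe]]]; subst G.
(* [Df x = - A B], and [A B] has positive determinant. *)
rewrite -[Df x]opprK -AB -scaleN1r unitmxZ ?unitrN1 // unitmxE unitfE gt_eqF //.
exact: dsr_det_mulmx_gt0.
Qed.
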